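(* Let $\star$ and $\star'$ be two star products of Wick type on a pseudo-K\''ahler manifold $(M,\omega,I)$ and let $\{\mathcal U_\gamma\}_{\gamma\in J}$ be a good open cover of $M$, where the $\mathcal U_\gamma$ are domains of holomorphic coordinates $z^1,\dots,z^n$ of $M$ (with $Z_k=\partial_{z^k}$, $\overline Z_l=\partial_{\overline z^l}$ on $\mathcal U_\gamma$). Moreover, let $K\in\omega+\nu Z^2_{\mathrm{dR}}(M,\mathbb C)^{1,1}[[\nu]]$ and let $\varphi_\gamma\in\mathcal C^\infty(\mathcal U_\gamma)[[\nu]]$ be formal local K\''ahler potentials of $K$, i.e. $K|_{\mathcal U_\gamma}=\partial\overline\partial\varphi_\gamma$. (i) If for all $\gamma\in J$, all $k$ and all $f\in\mathcal C^\infty(\mathcal U_\gamma)[[\nu]]$ we have $f\star Z_k(\varphi_\gamma)=f\star'Z_k(\varphi_\gamma)$, then $\star$ and $\star'$ coincide. (ii) If for all $\gamma\in J$, all $l$ and all $f\in\mathcal C^\infty(\mathcal U_\gamma)[[\nu]]$ we have $\overline Z_l(\varphi_\gamma)\star f=\overline Z_l(\varphi_\gamma)\star'f$, then $\star$ and $\star'$ coincide.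
   Context: $(M,\omega,I)$ is a pseudo-K\''ahler manifold, $\dim_{\mathbb R}M=2n$: $g$ is a pseudo-Riemannian metric, $I$ is an almost complex structure that is a $g$-isometry and is parallel for the Levi-Civita connection $\nabla$ of $g$; then $M$ is a complex manifold and $\omega(X,Y)=g(IX,Y)$ is a symplectic form. All functions and forms are smooth and complex-valued; the summation convention is used. In local holomorphic coordinates $Z_k=\partial_{z^k}$, $\overline Z_l=\partial_{\overline z^l}$, $\omega=\frac{\mathrm i}{2}g_{k\overline l}\,dz^k\wedge d\overline z^l$, $g^{k\overline l}g_{k\overline n}=\delta^{\overline l}_{\overline n}$, and $\{f,h\}=\frac{2}{\mathrm i}g^{k\overline l}(Z_k(f)\overline Z_l(h)-\overline Z_l(f)Z_k(h))$. $\mathcal O(U)$ and $\overline{\mathcal O}(U)$ denote holomorphic and anti-holomorphic functions on $U$. A star product on $(M,\omega,I)$ is a $\mathbb C[[\nu]]$-bilinear associative product $f\star h=\sum_{r\ge0}\nu^rC_r(f,h)$ on $\mathcal C^\infty(M)[[\nu]]$ with bidifferential operators $C_r$, $C_0(f,h)=fh$, $C_1(f,h)-C_1(h,f)=\{f,h\}$, and $C_r$ vanishing on constants for $r\ge1$; it restricts to open subsets of $M$, and the restriction is denoted by the same symbol. It is of Wick type if for all open $U\subseteq M$ and all $f,g,h,h'\in\mathcal C^\infty(M)$ with $h|_U\in\mathcal O(U)$, $h'|_U\in\overline{\mathcal O}(U)$ one has $f\star h|_U=fh|_U$ and $h'\star g|_U=h'g|_U$. $\nu Z^2_{\mathrm{dR}}(M,\mathbb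 C)^{1,1}[[\nu]]$ is the set of formal series in $\nu\Gamma^\infty(\bigwedge^2T^*M)[[\nu]]$ of closed two-forms of type $(1,1)$. *)

(* Defs.v *)
From HB Require Import structures.
From mathcomp Require Import all_boot all_order all_algebra.
From mathcomp Require Import all_classical all_reals all_analysis.
From mathcomp Require Import complex.

Set Implicit Arguments.
Unset Strict Implicit.
Unset Printing Implicit Defensive.

Import Order.TTheory GRing.Theory Num.Theory numFieldNormedType.Exports.

Local Open Scope classical_set_scope.
Local Open Scope ring_scope.

(* C^k on an open set V, by total differentiability; functions are total and
   only their values on V matter. *)
Fixpoint Ck (R : realType) (m k : nat) (V : set 'rV[R]_m)
    (f : 'rV[R]_m -> R) : Prop :=
  match k with
  | 0%N => forall x, V x -> {for x, continuous f}
  | k'.+1 => (forall x, V x -> differentiable f x) /\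
             (forall v, Ck k' V (fun x => 'D_v f x))
  end.

Definition Cinfty (R : realType) (m : nat) (V : set 'rV[R]_m)
    (f : 'rV[R]_m -> R) : Prop := forall k, Ck k V f.

Record chart (R : realType) (m : nat) (T : topologicalType) := Chart {
  dom : set T;
  coord : T -> 'rV[R]_m;
  coord_inv : 'rV[R]_m -> T;
  dom_open : open dom;
  range_open : open (coord @` dom);
  coordK : forall p, dom p -> coord_inv (coord p) = p;
  coord_cont : {within dom, continuous coord};
  coord_inv_cont : {within coord @` dom, continuous coord_inv} }.

Definition smooth_transition (R : realType) (m : nat) (T : topologicalType)
    (c c' : chart R m T) : Prop :=
  forall j, Cinfty (coord c @` (dom c `&` dom c'))
                   (fun x => coord c' (coord_inv c x) ord0 j).

Definition compatible (R : realType) (m : nat) (T : topologicalType)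
    (c c' : chart R m T) : Prop :=
  smooth_transition c c' /\ smooth_transition c' c.

Record smoothManifold (R : realType) (m : nat) := SmoothManifold {
  carrier :> topologicalType;
  atlas : set (chart R m carrier);
  manifold_hausdorff : hausdorff_space carrier;
  manifold_second_countable : @second_countable carrier;
  atlas_cover : forall p : carrier, exists2 c, atlas c & dom c p;
  atlas_compatible : forall c c', atlas c -> atlas c' -> compatible c c' }.

Section Manifold.
Variables (R : realType) (m : nat) (M : smoothManifold R m).

Local Notation chartM := (chart R m M).

(* membership in the maximal atlas *)
Definition smooth_chart (c : chartM) : Prop :=
  forall c', atlas c' -> compatible c c'.

Definition smoothR (U : set M) (f : M -> R) : Prop :=
  forall c, smooth_chart c ->
    Cinfty (coord c @` (dom c `&` U)) (f \o coord_inv c).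

Definition smooth (U : set M) (f : M -> R[i]) : Prop :=
  smoothR U (fun p => complex.Re (f p)) /\ smoothR U (fun p => complex.Im (f p)).

Definition partialR (c : chartM) (j : 'I_m) (f : M -> R) (p : M) : R :=
  'D_(delta_mx ord0 j) (f \o coord_inv c) (coord c p).

Definition partial (c : chartM) (j : 'I_m) (f : M -> R[i]) (p : M) : R[i] :=
  Complex (partialR c j (fun q => complex.Re (f q)) p)
          (partialR c j (fun q => complex.Im (f q)) p).

Definition partials (N : nat) (c : chartM) (alpha : {ffun 'I_m -> 'I_N.+1})
    (f : M -> R[i]) : M -> R[i] :=
  foldr (fun j F => iter (alpha j) (partial c j) F) f (enum 'I_m).

(* Tangent vectors at p are rows of components in a chart c, so that the
   components in another chart c' are v *m jac c c' p. *)
Definition jac (c c' : chartM) (p : M) : 'M[R]_m :=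
  \matrix_(i, j) partialR c i (fun q => coord c' q ord0 j) p.

(* Tensor fields are given by their components in all charts of the maximal
   atlas, subject to the transformation law; the values of a tensor field on
   other charts, or outside of the domain of a chart, are irrelevant. *)

Definition is_pseudo_riemannian (g : chartM -> M -> 'M[R]_m) : Prop :=
  forall c, smooth_chart c ->
  [/\ forall i j, smoothR (dom c) (fun p => g c p i j),
      forall p, dom c p -> (g c p)^T = g c p,
      forall p, dom c p -> g c p \in unitmx &
      forall c' p, smooth_chart c' -> dom c p -> dom c' p ->
        g c p = jac c c' p *m g c' p *m (jac c c' p)^T].

(* The endomorphism maps the i-th coordinate vector field of c to the vector
   field with components row i (I c p), i.e. it acts by v |-> v *m I c p. *)
Definition is_almost_complex (I : chartM -> M -> 'M[R]_m) : Prop :=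
  forall c, smooth_chart c ->
  [/\ forall i j, smoothR (dom c) (fun p => I c p i j),
      forall p, dom c p -> I c p *m I c p = - 1%:M &
      forall c' p, smooth_chart c' -> dom c p -> dom c' p ->
        I c p *m jac c c' p = jac c c' p *m I c' p].

Definition is_isometry (g I : chartM -> M -> 'M[R]_m) : Prop :=
  forall c p, smooth_chart c -> dom c p ->
    I c p *m g c p *m (I c p)^T = g c p.

(* christoffel g c p i j k is Gamma^k_(ij) of the Levi-Civita connection *)
Definition christoffel (g : chartM -> M -> 'M[R]_m) (c : chartM) (p : M)
    (i j k : 'I_m) : R :=
  2^-1 * \sum_l invmx (g c p) k l *
    (partialR c i (fun q => g c q j l) p + partialR c j (fun q => g c q i l) p
     - partialR c l (fun q => g c q i j) p).

(* (nabla_i I)_j^k = d_i I_j^k + Gamma^k_(il) I_j^l - Gamma^l_(ij) I_l^k *)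
Definition is_parallel (g I : chartM -> M -> 'M[R]_m) : Prop :=
  forall c p, smooth_chart c -> dom c p -> forall i j k,
    partialR c i (fun q => I c q j k) p
    + \sum_l christoffel g c p i l k * I c p j l
    - \sum_l christoffel g c p i j l * I c p l k = 0.

(* Complex two-forms; a c p i j is the value on the i-th and j-th coordinate
   vector fields. *)
Definition is_two_form (a : chartM -> M -> 'M[R[i]]_m) : Prop :=
  forall c, smooth_chart c ->
  [/\ forall i j, smooth (dom c) (fun p => a c p i j),
      forall p, dom c p -> (a c p)^T = - a c p &
      forall c' p, smooth_chart c' -> dom c p -> dom c' p ->
        a c p = map_mx (real_complex R) (jac c c' p) *m a c' p
                *m (map_mx (real_complex R) (jac c c' p))^T].

Definition closed_two_form (a : chartM -> M -> 'M[R[i]]_m) : Prop :=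
  forall c p, smooth_chart c -> dom c p -> forall i j k,
    partial c i (fun q => a c q j k) p + partial c j (fun q => a c q k i) p
    + partial c k (fun q => a c q i j) p = 0.

Definition bidifferential (B : (M -> R[i]) -> (M -> R[i]) -> M -> R[i]) : Prop :=
  (forall f h, smooth setT f -> smooth setT h -> smooth setT (B f h)) /\
  (forall c p, smooth_chart c -> dom c p ->
    exists V : set M, [/\ open V, V p, V `<=` dom c &
    exists (N : nat)
      (a : {ffun 'I_m -> 'I_N.+1} -> {ffun 'I_m -> 'I_N.+1} -> M -> R[i]),
      (forall alpha beta, smooth V (a alpha beta)) /\
      (forall f h, smooth setT f -> smooth setT h -> forall q, V q ->
        B f h q = \sum_alpha \sum_beta
          a alpha beta q * partials c alpha f q * partials c beta h q)]).

(* A global smooth function with the same germ at p as the locally defined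
   function f. *)
Definition extension (p : M) (f : M -> R[i]) : M -> R[i] :=
  xget (fun _ => 0) [set F | smooth setT F /\ \forall q \near p, F q = f q].

(* The restriction of a bidifferential operator B to an open set U, where f
   and h are smooth functions on U and p belongs to U; as B is local, the value
   does not depend on the choice of the extensions. *)
Definition restrict_op (B : (M -> R[i]) -> (M -> R[i]) -> M -> R[i])
    (f h : M -> R[i]) (p : M) : R[i] :=
  B (extension p f) (extension p h) p.

(* A formal series of functions is the sequence of its coefficients.  The
   operator star C is C[[nu]]-bilinear by construction when all the C r are
   bilinear. *)
Definition star (C : nat -> (M -> R[i]) -> (M -> R[i]) -> M -> R[i])
    (f h : nat -> M -> R[i]) (k : nat) (p : M) : R[i] :=
  \sum_(r < k.+1) \sum_(s < (k - r).+1) C r (f s) (h (k - r - s)%N) p.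

Definition star_restr (C : nat -> (M -> R[i]) -> (M -> R[i]) -> M -> R[i]) :
    (nat -> M -> R[i]) -> (nat -> M -> R[i]) -> nat -> M -> R[i] :=
  star (fun r => restrict_op (C r)).

Definition smooth_series (U : set M) (f : nat -> M -> R[i]) : Prop :=
  forall r, smooth U (f r).

Definition const_series (f : M -> R[i]) (r : nat) : M -> R[i] :=
  if r == 0%N then f else fun _ => 0.

Definition contractible (W : set M) : Prop :=
  exists (x0 : M) (H : R * M -> M),
  [/\ W x0, {within `[0, 1] `*` W, continuous H},
      forall t x, `[0, 1]%classic t -> W x -> W (H (t, x)),
      forall x, W x -> H (0, x) = x &
      forall x, W x -> H (1, x) = x0].

Definition good_open_cover (J : Type) (U : J -> set M) : Prop :=
  [/\ forall gamma, open (U gamma),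
      forall p, exists gamma, U gamma p &
      forall S : set J, finite_set S -> S !=set0 ->
        \bigcap_(gamma in S) U gamma !=set0 ->
        contractible (\bigcap_(gamma in S) U gamma)].

End Manifold.

Record pseudoKahler (R : realType) (n : nat) := PseudoKahler {
  manifold :> smoothManifold R (n + n);
  metric : chart R (n + n) manifold -> manifold -> 'M[R]_(n + n);
  cstruct : chart R (n + n) manifold -> manifold -> 'M[R]_(n + n);
  metricP : is_pseudo_riemannian metric;
  cstructP : is_almost_complex cstruct;
  cstruct_isometry : is_isometry metric cstruct;
  cstruct_parallel : is_parallel metric cstruct }.

Section PseudoKahler.
Variables (R : realType) (n : nat) (M : pseudoKahler R n).

Local Notation chartM := (chart R (n + n) M).
Local Notation matC := (map_mx (real_complex R)).

(* omega(X, Y) = g(I X, Y) *)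
Definition kahler_form (c : chartM) (p : M) : 'M[R[i]]_(n + n) :=
  matC (cstruct c p *m metric c p).

(* Holomorphic coordinates z^k = x^k + i y^k, ordered as
   (x^1, ..., x^n, y^1, ..., y^n), with I(d/dx^k) = d/dy^k. *)
Definition holomorphic_chart (c : chartM) : Prop :=
  smooth_chart c /\
  forall p, dom c p -> cstruct c p = block_mx 0 1%:M (- 1%:M) 0.

Definition Z (c : chartM) (k : 'I_n) (f : M -> R[i]) (p : M) : R[i] :=
  2^-1 * (partial c (lshift n k) f p - 'i%C * partial c (rshift n k) f p).

Definition Zbar (c : chartM) (k : 'I_n) (f : M -> R[i]) (p : M) : R[i] :=
  2^-1 * (partial c (lshift n k) f p + 'i%C * partial c (rshift n k) f p).

Definition Zvec (k : 'I_n) : 'rV[R[i]]_(n + n) :=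
  2^-1 *: (delta_mx ord0 (lshift n k) - 'i%C *: delta_mx ord0 (rshift n k)).

Definition Zbarvec (k : 'I_n) : 'rV[R[i]]_(n + n) :=
  2^-1 *: (delta_mx ord0 (lshift n k) + 'i%C *: delta_mx ord0 (rshift n k)).

Definition dz (k : 'I_n) : 'rV[R[i]]_(n + n) :=
  delta_mx ord0 (lshift n k) + 'i%C *: delta_mx ord0 (rshift n k).

Definition dzbar (k : 'I_n) : 'rV[R[i]]_(n + n) :=
  delta_mx ord0 (lshift n k) - 'i%C *: delta_mx ord0 (rshift n k).

(* (a /\ b)(X, Y) = a(X) b(Y) - a(Y) b(X) *)
Definition wedge (a b : 'rV[R[i]]_(n + n)) : 'M[R[i]]_(n + n) :=
  a^T *m b - b^T *m a.

(* the matrix of the g_(k lbar) with omega = i/2 g_(k lbar) dz^k /\ dzbar^l *)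
Definition gherm (c : chartM) (p : M) : 'M[R[i]]_n :=
  \matrix_(k, l) (2 / 'i%C *
    (Zvec k *m kahler_form c p *m (Zbarvec l)^T) ord0 ord0).

(* g^(k lbar) g_(k nbar) = delta^l_n makes the matrix of the g^(k lbar) the
   transpose of invmx (gherm c p). *)
Definition poisson (c : chartM) (f h : M -> R[i]) (p : M) : R[i] :=
  2 / 'i%C * \sum_k \sum_l invmx (gherm c p) l k *
    (Z c k f p * Zbar c l h p - Zbar c l f p * Z c k h p).

Definition holomorphic (U : set M) (f : M -> R[i]) : Prop :=
  smooth U f /\
  forall c p, holomorphic_chart c -> dom c p -> U p ->
    forall l, Zbar c l f p = 0.

Definition antiholomorphic (U : set M) (f : M -> R[i]) : Prop :=
  smooth U f /\
  forall c p, holomorphic_chart c -> dom c p -> U p ->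
    forall k, Z c k f p = 0.

(* type (1,1): zero on pairs of vectors that are both of type (1,0), or both
   of type (0,1), i.e. both in the same eigenspace of I for i or - i *)
Definition type11 (a : chartM -> M -> 'M[R[i]]_(n + n)) : Prop :=
  forall c p, smooth_chart c -> dom c p ->
  forall e : R[i], e = 'i%C \/ e = - 'i%C ->
  forall v w : 'rV[R[i]]_(n + n),
    v *m matC (cstruct c p) = e *: v -> w *m matC (cstruct c p) = e *: w ->
    v *m a c p *m w^T = 0.

(* the component matrix, in the coordinates of the holomorphic chart c, of
   del delbar f = Z_k(Zbar_l(f)) dz^k /\ dzbar^l *)
Definition deldelbar (c : chartM) (f : M -> R[i]) (p : M) : 'M[R[i]]_(n + n) :=
  \sum_k \sum_l Z c k (Zbar c l f) p *: wedge (dz k) (dzbar l).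

(* K is an element of omega + nu Z^2_dR(M, C)^(1,1)[[nu]] *)
Definition formal_deformation (K : nat -> chartM -> M -> 'M[R[i]]_(n + n)) :
    Prop :=
  (forall c p, smooth_chart c -> dom c p -> K 0%N c p = kahler_form c p) /\
  (forall r, [/\ is_two_form (K r.+1), closed_two_form (K r.+1) &
                 type11 (K r.+1)]).

Definition star_product
    (C : nat -> (M -> R[i]) -> (M -> R[i]) -> M -> R[i]) : Prop :=
  [/\ forall r, bidifferential (C r),
      forall f h, smooth setT f -> smooth setT h ->
        forall p, C 0%N f h p = f p * h p,
      forall f h, smooth setT f -> smooth setT h ->
        forall c p, holomorphic_chart c -> dom c p ->
          C 1%N f h p - C 1%N h f p = poisson c f h p,
      forall r f (a : R[i]), smooth setT f -> forall p,
        C r.+1 (fun _ => a) f p = 0 /\ C r.+1 f (fun _ => a) p = 0 &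
      forall f1 f2 f3, smooth_series setT f1 -> smooth_series setT f2 ->
        smooth_series setT f3 -> forall k p,
        star C (star C f1 f2) f3 k p = star C f1 (star C f2 f3) k p].

Definition wick_type
    (C : nat -> (M -> R[i]) -> (M -> R[i]) -> M -> R[i]) : Prop :=
  forall (U : set M) (f g h h' : M -> R[i]),
    open U -> smooth setT f -> smooth setT g ->
    smooth setT h -> smooth setT h' ->
    holomorphic U h -> antiholomorphic U h' ->
    forall k p, U p ->
      star C (const_series f) (const_series h) k p
        = const_series (fun q => f q * h q) k p /\
      star C (const_series h') (const_series g) k p
        = const_series (fun q => h' q * g q) k p.

Definition coincide
    (C C' : nat -> (M -> R[i]) -> (M -> R[i]) -> M -> R[i]) : Prop :=
  forall f h, smooth_series setT f -> smooth_series setT h ->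
    forall k p, star C f h k p = star C' f h k p.

End PseudoKahler.

(* Main.v *)
Require Import Defs.
From mathcomp Require Import all_boot all_order all_algebra.
From mathcomp Require Import all_classical all_reals all_analysis.
From mathcomp Require Import complex.
From mathcomp Require Import ring lra zify.

Set Implicit Arguments.
Unset Strict Implicit.
Unset Printing Implicit Defensive.

Import Order.TTheory GRing.Theory Num.Theory numFieldNormedType.Exports.

Local Open Scope classical_set_scope.
Local Open Scope ring_scope.

Local Notation coord := Defs.coord.

(** Suppose that the two products agree up to the order [r - 1] in the formal
    parameter and let [D] be the difference of their coefficients of order [r].
    Comparing the two associativity laws at the order [r] only leaves the terms
    with [D] and the pointwise product, so that [D] is a Hochschild cocycle
    ([difference_cocycle]):
      [D(f, g) h + D(f g, h) = f D(g, h) + D(f, g h)].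
    If [w] is a function with [D(-, w) = 0] at a point [p], this says that
    [D(f, g w) = w(p) D(f, g)] at [p]: the functional [L = D(f, -)(p)] sees
    [w] only through its value.  The Wick property provides such functions, the
    holomorphic coordinates [z^k]; the hypothesis of (i), read at the order [r],
    provides the functions [Z_k(phi_0)], where [phi_0] is the leading term of
    the potential.  The differentials at [p] of these [2n] functions form a
    basis of the complexified cotangent space: a tangent vector killed by all
    [dz^k] is of type (0,1), and if it also kills all [Z_k(phi_0)] then it is in
    the kernel of the form with coefficients [Zbar_l(Z_k(phi_0))], which is the
    nondegenerate form [omega] ([frame_Z_unit]).

    It remains to see that such a functional [L] vanishes ([functional_eq0]).
    As [D] is bidifferential, [L] kills the functions that vanish to some high
    order at [p].  If [L] kills the functions vanishing to the order [k + 1]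
    and [f] vanishes to the order [k > 0], then by Euler's identity [k f] equals
    [sum_i x_i d_i f] up to the order [k + 1], where the coordinates [x_i]
    centered at [p] are linear combinations of the [w - w(p)] up to the order 2.
    But [L] kills the multiples of [w - w(p)], so [L(f) = 0].  Descending on
    [k] one is left with the constants, which [L] kills as well.

    Part (ii) is the mirror image: the first argument of [D] varies and the
    antiholomorphic coordinates replace the holomorphic ones.

    The bidifferential operators act on global functions, whereas coordinates
    and potentials are local.  Hence the need for bump functions
    ([exists_bump]), which turn germs into global functions ([exists_global]),
    and for the symmetry of second derivatives ([derive_swap]). *)

(** * Calculus of the classes [Ck] on Euclidean space *)

Lemma near_eq_differentiable (R : numFieldType) (V W : normedModType R)
    (f g : V -> W) (x : V) :
  (\forall y \near x, f y = g y) -> differentiable f x -> differentiable g x.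
Proof.
move=> fg df; rewrite (_ : g = f + (g - f)); last by rewrite addrC subrK.
apply: differentiableD => //; set d := g - f.
have d0 : \forall y \near x, d y = 0.
  by apply: filterS fg => y; rewrite /d !fctE => ->; rewrite subrr.
have dx : d x = 0 by exact: (nbhs_singleton d0).
have E : d \o shift x = cst (d x) + \0 +o_ 0 id.
  apply/eqaddoP => _/posnumP[e]; rewrite dx.
  have {}d0 : \forall y \near (0 : V), d (y + x) = 0.
    by move: d0; rewrite (near_shift 0) /= subr0.
  by apply: filterS d0 => y dy; rewrite /= !fctE /= dy addr0 subr0 normr0 mulr_ge0.
apply/diff_locallyP.
have -> : 'd d x = \0 :> (V -> W).
  by apply: (@diff_unique _ V W d \0) => //; exact: cst_continuous.
by split=> //; exact: cst_continuous.
Qed.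

Section Euclidean.
Variables (R : realType) (m : nat).
Implicit Types (V W : set 'rV[R]_m) (f g : 'rV[R]_m -> R) (k : nat).

(** Being of class [Ck] is a condition at each point, which lets open sets be
    shrunk freely and reduces smoothness on a manifold to one chart around each
    point. *)
Lemma Ck_pointwise k V f :
  Ck k V f <-> forall x, V x -> Ck k [set x] f.
Proof.
elim: k V f => [|k IH] V f /=.
  by split=> [H x Vx _ ->|H x Vx]; [exact: H | apply: H Vx _ _].
split=> [[H1 H2] x Vx|H].
  split=> [_ ->|v]; first exact: H1.
  exact: (IH V _).1 (H2 v) x Vx.
split=> [x Vx|v]; first exact: (H x Vx).1.
by apply/IH => x Vx; exact: (H x Vx).2.
Qed.

Lemma Ck_near k x f g :
  (\forall y \near x, f y = g y) -> Ck k [set x] f -> Ck k [set x] g.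
Proof.
elim: k x f g => [|k IH] x f g fg /=.
  move=> H _ ->; have fx := H x erefl.
  have fgx : f x = g x by exact: (nbhs_singleton fg).
  rewrite /prop_for /continuous_at -fgx.
  exact: (cvg_trans (near_eq_cvg fg) fx).
move=> [H1 H2]; split=> [_ ->|v].
  exact: near_eq_differentiable fg (H1 _ _).
apply: IH (H2 v); move/near_join: fg.
by apply: filterS => y; exact: near_eq_derive.
Qed.

Lemma open_near_eq V f g x : open V -> V x ->
  (forall y, V y -> f y = g y) -> \forall y \near x, f y = g y.
Proof.
by move=> oV Vx fg; apply: filterS (open_nbhs_nbhs (conj oV Vx)).
Qed.

Lemma Ck_eq k V f g : open V -> (forall y, V y -> f y = g y) ->
  Ck k V f -> Ck k V g.
Proof.
move=> oV fg /Ck_pointwise H; apply/Ck_pointwise => x Vx.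
exact: Ck_near (open_near_eq oV Vx fg) (H x Vx).
Qed.

Lemma Ck_sub k V W f : V `<=` W -> Ck k W f -> Ck k V f.
Proof.
by move=> VW /Ck_pointwise H; apply/Ck_pointwise => x /VW; exact: H.
Qed.

Lemma Ck_pred k V f : Ck k.+1 V f -> Ck k V f.
Proof.
elim: k f => [|k IH] f /= [H1 H2].
  by move=> x Vx; exact/differentiable_continuous/H1.
by split=> // v; apply: IH; exact: H2.
Qed.

Lemma Ck_cst k V (a : R) : Ck k V (fun=> a).
Proof.
elim: k a => [|k IH] a /=; first by move=> x _; exact: cst_continuous.
split=> [x _|v]; first exact: differentiable_cst.
rewrite (_ : 'D_v (fun=> a) = fun=> 0); first exact: IH.
by apply/funext => x; rewrite derive_cst.
Qed.

Lemma CkD k V f g : open V -> Ck k V f -> Ck k V g -> Ck k V (fun x => f x + g x).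
Proof.
move=> oV; elim: k f g => [|k IH] f g /=.
  by move=> H1 H2 x Vx; apply: continuousD; [exact: H1 | exact: H2].
move=> [f1 f2] [g1 g2]; split=> [x Vx|v].
  by apply: differentiableD; [exact: f1 | exact: g1].
apply: Ck_eq oV _ (IH _ _ (f2 v) (g2 v)) => x Vx.
by rewrite -deriveD//; apply: diff_derivable; do ?[exact: f1|exact: g1].
Qed.

Lemma CkM k V f g : open V -> Ck k V f -> Ck k V g -> Ck k V (fun x => f x * g x).
Proof.
move=> oV; elim: k f g => [|k IH] f g.
  by move=> /= H1 H2 x Vx; apply: continuousM; [exact: H1 | exact: H2].
move=> Hf Hg; have [f1 f2] := Hf; have [g1 g2] := Hg.
split=> [x Vx|v].
  by apply: differentiableM; [exact: f1 | exact: g1].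
apply: (@Ck_eq _ _ (fun x => f x * 'D_v g x + g x * 'D_v f x)) => //.
  move=> x Vx; have := @deriveM R _ f g x v.
  by move=> <-; rewrite //; apply: diff_derivable; do ?[exact: f1|exact: g1].
by apply: CkD => //; apply: IH => //; do ?exact: Ck_pred; do ?[exact: f2|exact: g2].
Qed.

Lemma Ck_coord k V (j : 'I_m) : Ck k V (fun x => x ord0 j).
Proof.
case: k => [|k] /=; first by move=> x _; exact: coord_continuous.
split=> [x _|v]; first exact: differentiable_coord.
rewrite (_ : 'D_v (fun x : 'rV[R]_m => x ord0 j) = fun=> v ord0 j); first exact: Ck_cst.
apply/funext => x.
have := derive_mx (@derivable_id R _ x v).
by rewrite derive_id => /matrixP /(_ ord0 j); rewrite mxE.
Qed.


Lemma Ck_sum k V n (F : 'I_n -> 'rV[R]_m -> R) : open V ->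
  (forall i, Ck k V (F i)) -> Ck k V (fun x => \sum_i F i x).
Proof.
move=> oV; elim: n F => [|n IH] F HF.
  rewrite (_ : (fun x => _) = fun=> 0); first exact: Ck_cst.
  by apply/funext => x; rewrite big_ord0.
rewrite (_ : (fun x => _) = fun x => F ord0 x + \sum_(i < n) F (lift ord0 i) x).
  by apply: CkD => //; apply: IH.
by apply/funext => x; rewrite big_ord_recl.
Qed.

Lemma Ck_prod k V n (F : 'I_n -> 'rV[R]_m -> R) : open V ->
  (forall i, Ck k V (F i)) -> Ck k V (fun x => \prod_i F i x).
Proof.
move=> oV; elim: n F => [|n IH] F HF.
  rewrite (_ : (fun x => _) = fun=> 1); first exact: Ck_cst.
  by apply/funext => x; rewrite big_ord0.
rewrite (_ : (fun x => _) = fun x => F ord0 x * \prod_(i < n) F (lift ord0 i) x).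
  by apply: CkM => //; apply: IH.
by apply/funext => x; rewrite big_ord_recl.
Qed.

End Euclidean.

Lemma continuous_of_components (R : realType) (T : topologicalType) m (u : T -> 'rV[R]_m) x :
  (forall j, {for x, continuous (fun y => u y ord0 j)}) -> {for x, continuous u}.
Proof.
move=> H; apply/cvgrPdist_le => e e0; near=> y.
rewrite /Num.Def.normr/= mx_normrE (bigmax_le _ (ltW e0))//= => -[i j] _.
rewrite !mxE /= (ord1 i); move: j; near: y; apply: filter_forall => j.
by move/cvgrPdist_le : (H j); apply.
Unshelve. all: by end_near. Qed.

Lemma differentiable_of_components (R : realType) p m (u : 'rV[R]_p -> 'rV[R]_m) x :
  (forall j, differentiable (fun y => u y ord0 j) x) -> differentiable u x.
Proof.
move=> H.
rewrite (_ : u = \sum_j (fun y => u y ord0 j *: (delta_mx ord0 j : 'rV[R]_m))).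
  by apply: differentiable_sum => j; exact: differentiableZl.
apply/funext => y; rewrite fct_sumE.
exact: row_sum_delta.
Qed.

Lemma derive_comp_rV (R : realType) p m (u : 'rV[R]_p -> 'rV[R]_m) f x v :
  (forall j, differentiable (fun y => u y ord0 j) x) -> differentiable f (u x) ->
  'D_v (f \o u) x
  = \sum_j 'D_v (fun y => u y ord0 j) x * 'D_(delta_mx ord0 j) f (u x) :> R.
Proof.
move=> du df; have du' := differentiable_of_components du.
rewrite deriveE; last exact: differentiable_comp.
have -> : 'd (f \o u) x v = 'd f (u x) ('d u x v) by rewrite diff_comp.
have -> : 'd u x v = 'D_v u x by rewrite deriveE.
rewrite [X in 'd _ _ X]row_sum_delta linear_sum; apply: eq_bigr => j _.
by rewrite linearZ /= -deriveE// derive_mx ?mxE//; exact: diff_derivable.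
Qed.

Lemma Ck_comp (R : realType) p m k (V : set 'rV[R]_p) (W : set 'rV[R]_m) u f :
  open V -> open W -> (forall x, V x -> W (u x)) ->
  (forall j, Ck k V (fun x => u x ord0 j)) -> Ck k W f -> Ck k V (f \o u).
Proof.
move=> oV oW uVW; elim: k f => [|k IH] f.
  move=> /= Hu Hf x Vx; apply: continuous_comp; last exact/Hf/uVW.
  by apply: continuous_of_components => j; exact: Hu.
move=> Hu Hf; have [f1 f2] := Hf.
have u1 x : V x -> forall j, differentiable (fun y => u y ord0 j) x.
  by move=> Vx j; exact: (Hu j).1.
split=> [x Vx|v].
  by apply: differentiable_comp; [exact/differentiable_of_components/u1 | exact/f1/uVW].
apply: (@Ck_eq _ _ _ _ (fun x => \sum_j 'D_v (fun y => u y ord0 j) x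
                        * 'D_(delta_mx ord0 j) f (u x))) => //.
  by move=> x Vx; rewrite derive_comp_rV//; [exact: u1 | exact/f1/uVW].
apply: (@Ck_sum _ _ _ _ _ (fun j x => 'D_v (fun y => u y ord0 j) x
                        * 'D_(delta_mx ord0 j) f (u x))) => // j.
apply: CkM => //; first exact: (Hu j).2.
exact: (IH ('D_(delta_mx ord0 j) f) (fun i => Ck_pred (Hu i)) (f2 _)).
Qed.

(** * Symmetry of second derivatives *)

Section Schwarz.
Variables (R : realType) (m : nat).
Implicit Types (V : set 'rV[R]_m) (f : 'rV[R]_m -> R) (x u v : 'rV[R]_m).

(** Restricting to lines makes the one-dimensional mean value theorem
    applicable. *)
Lemma is_derive_line f y u (s : R) : derivable f (s *: u + y) u ->
  is_derive s 1 (fun t : R => f (t *: u + y)) ('D_u f (s *: u + y)).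
Proof.
have E : (fun h : R => h^-1 *: (((fun t : R => f (t *: u + y)) \o shift s) (h *: 1)
                 - f (s *: u + y)))
       = (fun h => h^-1 *: ((f \o shift (s *: u + y)) (h *: u) - f (s *: u + y))).
  apply/funext => h; congr (_ *: (f _ - _)).
  by rewrite /= [h *: 1]mulr1 scalerDl addrA.
move=> df; apply: DeriveDef; first by rewrite /derivable E.
by rewrite /derive E.
Qed.

(** Apply the mean value theorem twice: to the first difference in the
    direction [v], as a function along [u], and then to ['D_u f] along [v]. *)
Lemma second_difference V f x u v (h : R) : 0 < h ->
  (forall s t, 0 <= s <= h -> 0 <= t <= h -> V (s *: u + (t *: v + x))) ->
  Ck 2 V f ->
  exists s t, [/\ 0 < s < h, 0 < t < h &
    f (h *: u + (h *: v + x)) - f (h *: u + x) - f (h *: v + x) + f x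
    = h ^+ 2 * 'D_v ('D_u f) (s *: u + (t *: v + x))].
Proof.
move=> h0 HV [f1 f2].
have HV0 s : 0 <= s <= h -> V (s *: u + x).
  by move=> hs; have := HV s 0 hs; rewrite scale0r add0r; apply; rewrite lexx ltW.
pose phi (s : R) := f (s *: u + (h *: v + x)) - f (s *: u + x).
pose dphi (s : R) := 'D_u f (s *: u + (h *: v + x)) - 'D_u f (s *: u + x).
have dphiP s : 0 <= s <= h -> is_derive s 1 phi (dphi s).
  move=> hs; apply: is_deriveB; apply: is_derive_line; apply: diff_derivable; apply: f1.
    by apply: HV => //; rewrite lexx ltW.
  exact: HV0.
have [s] : exists2 s, s \in `]0, h[%R & phi h - phi 0 = dphi s * (h - 0).
  apply: (@MVT R phi dphi) => // [s|].
    by rewrite in_itv/= => /andP[s0 sh]; apply: dphiP; rewrite !ltW.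
  apply: derivable_within_continuous => s.
  by rewrite in_itv/= => /dphiP [].
rewrite in_itv/= => hs E1; have hs' : 0 <= s <= h by case/andP: hs => *; rewrite !ltW.
pose dpsi (t : R) := 'D_v ('D_u f) (t *: v + (s *: u + x)).
pose psi (t : R) := 'D_u f (t *: v + (s *: u + x)).
have psiP t : 0 <= t <= h ->
    is_derive t 1 psi (dpsi t).
  move=> ht; apply: (@is_derive_line ('D_u f)); apply: diff_derivable.
  by apply: (f2 u).1; rewrite addrCA; exact: HV.
have [t] : exists2 t, t \in `]0, h[%R &
    psi h - psi 0 = dpsi t * (h - 0).
  apply: (@MVT R psi dpsi 0 h h0).
    by move=> t; rewrite in_itv/= => /andP[t0 th]; apply: psiP; rewrite !ltW.
  apply: derivable_within_continuous => t.
  by rewrite in_itv/= => /psiP [].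
rewrite in_itv/= => ht E2; exists s, t; split=> //.
have <- : phi h - phi 0
    = f (h *: u + (h *: v + x)) - f (h *: u + x) - f (h *: v + x) + f x.
  by rewrite /phi !scale0r !add0r opprB addrA; ring.
have Edphi : dphi s = psi h - psi 0.
  by rewrite /dphi /psi scale0r add0r [h *: v + (_ + x)]addrCA.
rewrite E1 Edphi E2 /dpsi subr0 [t *: v + (_ + x)]addrCA; ring.
Qed.

(** The second difference is symmetric in [u] and [v], so by
    [second_difference] both mixed derivatives take the same value at points
    arbitrarily close to [x]; they are continuous. *)
Lemma derive_swap V f x u v : open V -> V x -> Ck 2 V f ->
  'D_u ('D_v f) x = 'D_v ('D_u f) x.
Proof.
move=> oV Vx Hf; apply/eqP; rewrite -subr_eq0 -normr_le0.
apply/ler_addgt0Pr => e e0; rewrite add0r.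
have e20 : 0 < e / 2 by rewrite divr_gt0.
have cont a b : \forall y \near x, `|'D_a ('D_b f) x - 'D_a ('D_b f) y| < e / 2.
  have : {for x, continuous ('D_a ('D_b f))} by exact: ((Hf.2 b).2 a).
  by move/cvgrPdist_lt; apply.
have : \forall y \near x, [/\ V y,
    `|'D_u ('D_v f) x - 'D_u ('D_v f) y| < e / 2 &
    `|'D_v ('D_u f) x - 'D_v ('D_u f) y| < e / 2].
  apply: filterS3 (open_nbhs_nbhs (conj oV Vx)) (cont u v) (cont v u).
  by move=> y *; split.
move/nbhs_ballP => [d /= d0 Hd].
(* With this side length the whole parallelogram stays in the ball of radius d. *)
pose h := d / (`|u| + `|v| + 1).
have N0 : 0 < `|u| + `|v| + 1 by rewrite ltr_pwDr// addr_ge0.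
have h0 : 0 < h by rewrite divr_gt0.
have Hb s t : 0 <= s <= h -> 0 <= t <= h -> ball x d (s *: u + (t *: v + x)).
  move=> /andP[s0 sh] /andP[t0 th]; rewrite -ball_normE /= addrA opprD addrCA subrr addr0 normrN.
  apply: (le_lt_trans (ler_normD _ _)); rewrite !normrZ !ger0_norm//.
  apply: (@le_lt_trans _ _ (h * (`|u| + `|v|))).
    by rewrite mulrDr lerD// ler_wpM2r.
  by rewrite /h mulrAC ltr_pdivrMr// ltr_pM2l// ltrDl.
have HV s t : 0 <= s <= h -> 0 <= t <= h -> V (s *: u + (t *: v + x)).
  by move=> hs ht; have [] := Hd _ (Hb _ _ hs ht).
have HV' s t : 0 <= s <= h -> 0 <= t <= h -> V (s *: v + (t *: u + x)).
  by move=> hs ht; rewrite addrCA; exact: HV.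
have [s [t [hs ht E1]]] := second_difference h0 HV Hf.
have [s' [t' [hs' ht' E2]]] := second_difference h0 HV' Hf.
have ltW2 a : 0 < a < h -> 0 <= a <= h by case/andP => *; rewrite !ltW.
have [_ _ D1] := Hd _ (Hb _ _ (ltW2 _ hs) (ltW2 _ ht)).
have [_ D2 _] := Hd _ (Hb _ _ (ltW2 _ ht') (ltW2 _ hs')).
rewrite [s' *: v + _]addrCA [h *: v + (h *: u + x)]addrCA in E2.
set a := 'D_v ('D_u f) (s *: u + (t *: v + x)) in D1 E1.
set b := 'D_u ('D_v f) (t' *: u + (s' *: v + x)) in D2 E2.
have E : a = b.
  have h2 : h ^+ 2 != 0 by rewrite expf_eq0 /= gt_eqF.
  apply: (mulfI h2); apply: etrans (esym E1) _; apply: etrans E2; ring.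
rewrite -E in D2.
move: ('D_u ('D_v f) x) ('D_v ('D_u f) x) D1 D2 => p q.
by rewrite ler_norml !ltr_norml => /andP[? ?] /andP[? ?]; apply/andP; split; lra.
Qed.

End Schwarz.

(** * Flat functions and bump functions *)

Section FlatFunction.
Variable R : realType.
Implicit Types (P : {poly R}) (x y : R).

(** The functions [P(1/x) exp(-1/x)], extended by zero: the polynomial factor
    makes the class closed under differentiation, which gives smoothness by
    induction. *)
Definition flat P x : R := if 0 < x then P.[x^-1] * expR (- x^-1) else 0.

Lemma flat_le0 P x : x <= 0 -> flat P x = 0.
Proof. by rewrite /flat ltNge => ->. Qed.

(** Each monomial is bounded by the corresponding term of the exponential
    series. *)
Lemma poly_expR_bounded P :
  exists2 C, 0 <= C & forall y, 0 < y -> `|P.[y] * expR (- y)| <= C.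
Proof.
exists (\sum_(i < size P) `|P`_i| * i`!%:R).
  by apply: sumr_ge0 => i _; rewrite mulr_ge0.
move=> y y0; rewrite horner_coef mulr_suml.
apply: (le_trans (ler_norm_sum _ _ _)); apply: ler_sum => i _.
rewrite -mulrA normrM ler_wpM2l//.
have yi : y ^+ i <= i`!%:R * expR y.
  case: (i : nat) => [|j]; first by rewrite expr0 fact0 mul1r -expR0 ler_expR ltW.
  have := @expR_ge1Dxn R y j (ltW y0).
  rewrite -ler_pdivrMl ?ltr0n ?fact_gt0// mulrC; apply: le_trans.
  by rewrite lerDr.
rewrite ger0_norm ?mulr_ge0 ?exprn_ge0 ?expR_ge0 ?(ltW y0)//.
by rewrite expRN ler_pdivrMr ?expR_gt0.
Qed.

(** Away from zero this is the product rule.  At zero the difference quotient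
    for [h > 0] is [h] times the bounded function [y^2 P(y) exp(-y)] with [y = 1/h]. *)
Lemma is_derive_flat P x : is_derive x 1 (flat P) (flat ('X^2 * (P - P^`())) x).
Proof.
have [x0|x0|->] := ltgtP x 0.
- rewrite (flat_le0 _ (ltW x0)); apply: (@near_eq_is_derive _ _ _ (cst 0)).
    near=> y; rewrite flat_le0//; near: y.
    by apply: filterS (lt_nbhsl x0) => y /ltW.
- have xn0 : x != 0 by rewrite gt_eqF.
  apply: (@near_eq_is_derive _ _ _ ((horner P \o GRing.inv) * (expR \o (-%R \o GRing.inv)))).
    near=> y; rewrite /flat ifT//; near: y.
    exact: lt_nbhsr.
  have dinv : is_derive x 1 (@GRing.inv R) (- x ^- 2).
    by apply: is_derive_eq (is_deriveV xn0 (is_derive_id x 1)) _; rewrite scaler1.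
  apply: is_derive_eq.
  rewrite /flat x0 hornerM hornerXn hornerD hornerN -exprVn /GRing.scale /=; ring.
- rewrite flat_le0//.
  have [C C0 HC] := poly_expR_bounded ('X^2 * P).
  have C1 : 0 < C + 1 by rewrite ltr_wpDl.
  have L : (fun h : R => h^-1 *: ((flat P \o shift 0) (h *: 1) - flat P 0)) @ 0^' --> (0 : R).
    apply/cvgrPdist_le => e e0; near=> h.
    rewrite /= sub0r normrN (flat_le0 _ (lexx 0)) subr0 addr0 [h *: 1]mulr1.
    have [h0|h0] := leP h 0; first by rewrite flat_le0// scaler0 normr0 ltW.
    have hn0 : h != 0 by rewrite gt_eqF.
    rewrite /flat h0 (_ : _ *: _ = h * (('X^2 * P).[h^-1] * expR (- h^-1))); last first.
      by rewrite hornerM hornerXn /GRing.scale /=; field.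
    rewrite normrM gtr0_norm// (le_trans (ler_wpM2l (ltW h0) (HC _ _)))// ?invr_gt0//.
    apply: (@le_trans _ _ (h * (C + 1))); first by rewrite ler_wpM2l ?ltW// ltrDl.
    rewrite -ler_pdivlMr// -[h]gtr0_norm//; near: h.
    by apply: dnbhs0_le; rewrite divr_gt0.
  apply: DeriveDef; first by apply/cvg_ex; exists 0.
  exact: cvg_lim L.
Unshelve. all: by end_near. Qed.

End FlatFunction.

Section Bump.
Variables (R : realType) (m : nat).
Implicit Types (V : set 'rV[R]_m) (x : 'rV[R]_m).

Lemma Ck_flat k V P (u : 'rV[R]_m -> R) :
  open V -> Ck k V u -> Ck k V (fun x => flat P (u x)).
Proof.
move=> oV; have dflat (Q : {poly R}) (y : R) : differentiable (flat Q) y.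
  by apply/derivable1_diffP; have [] := is_derive_flat Q y.
elim: k P u => [|k IH] P u.
  move=> /= Hu x Vx; apply: (@continuous_comp _ _ _ u (flat P)); first exact: Hu.
  exact: differentiable_continuous.
move=> Hu; have [u1 u2] := Hu.
have du x (Vx : V x) := differentiable_comp (u1 x Vx) (dflat P (u x)).
split=> [x Vx|v]; first exact: du.
apply: (@Ck_eq _ _ _ _ (fun x => 'D_v u x * flat ('X^2 * (P - P^`())) (u x))) => //.
  move=> x Vx; rewrite [RHS]deriveE; last exact: du.
  rewrite (diff_comp (u1 x Vx) (dflat P (u x))) /=.
  rewrite diff1E// derive1E -deriveE; last exact: u1.
  by have [_ ->] := is_derive_flat P (u x).
by apply: CkM => //; [exact: u2 | exact/IH/Ck_pred].
Qed.

(** Nesting two flat functions avoids a quotient: the inner one vanishes for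
    small [t], and the argument of the outer one is nonpositive for [1 <= |t|]. *)
Definition plateau (t : R) : R :=
  flat 1 (expR (- 1) - flat 1 (4 * t ^+ 2 - 1)) / flat 1 (expR (- 1)).

Lemma plateau_eq1 t : `|t| <= 2^-1 -> plateau t = 1.
Proof.
move=> t2; rewrite /plateau (@flat_le0 _ _ (4 * t ^+ 2 - 1)); last first.
  by rewrite -real_normK ?num_real//; have := normr_ge0 t; nra.
rewrite subr0 divff// /flat expR_gt0 hornerC mul1r.
by rewrite gt_eqF// expR_gt0.
Qed.

Lemma plateau_eq0 t : 1 <= `|t| -> plateau t = 0.
Proof.
move=> t1; rewrite /plateau flat_le0 ?mul0r//.
have t3 : 1 <= 4 * t ^+ 2 - 1.
  by rewrite -real_normK ?num_real//; nra.
have t0 := lt_le_trans ltr01 t3.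
rewrite subr_le0 /flat t0 hornerC mul1r ler_expR lerN2.
by rewrite invf_le1.
Qed.

Lemma Ck_plateau k V (u : 'rV[R]_m -> R) :
  open V -> Ck k V u -> Ck k V (fun x => plateau (u x)).
Proof.
move=> oV Hu; rewrite /plateau; apply: CkM => //; last exact: Ck_cst.
have HN (f : 'rV[R]_m -> R) : Ck k V f -> Ck k V (fun x => - f x).
  move=> Hf; rewrite (_ : (fun x => _) = (fun x => -1 * f x)).
    by apply: CkM => //; exact: Ck_cst.
  by apply/funext => x; rewrite mulN1r.
apply: Ck_flat => //; apply: CkD => //; first exact: Ck_cst.
apply: HN; apply: Ck_flat => //; apply: CkD => //; last exact: Ck_cst.
apply: CkM => //; first exact: Ck_cst.
rewrite (_ : (fun x => _) = (fun x => u x * u x)); first exact: CkM.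
by apply/funext => x; rewrite expr2.
Qed.

(** The norm on row vectors is the maximum norm, so a product of plateaus over
    the coordinates is supported in a small cube. *)
Lemma exists_bump V x : open V -> V x ->
  exists (b : 'rV[R]_m -> R) (K : set 'rV[R]_m),
  [/\ Cinfty setT b, \forall y \near x, b y = 1,
      forall y, ~ K y -> b y = 0, compact K & K `<=` V].
Proof.
move=> oV Vx; have /nbhs_ballP[e /= e0 He] := open_nbhs_nbhs (conj oV Vx).
pose d := e / 2; have d0 : 0 < d by rewrite divr_gt0.
exists (fun y => \prod_j plateau ((y ord0 j - x ord0 j) / d)).
exists [set y | forall j, `[x ord0 j - d, x ord0 j + d]%classic (y ord0 j)]; split.
- move=> k; apply: (@Ck_prod _ _ _ _ _ (fun j y => plateau ((y ord0 j - x ord0 j) / d))).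
    exact: openT.
  move=> j; apply: Ck_plateau; first exact: openT.
  apply: CkM; [exact: openT| |exact: Ck_cst].
  by apply: CkD; [exact: openT|exact: Ck_coord|exact: Ck_cst].
- apply/nbhs_ballP; exists (d / 2) => /=; first by rewrite divr_gt0.
  move=> y; rewrite -ball_normE /= => Hy; rewrite big1// => j _.
  rewrite plateau_eq1// normrM normfV (gtr0_norm d0) ler_pdivrMr// mulrC distrC.
  apply: le_trans (ltW Hy); rewrite [leRHS]/Num.Def.normr/= mx_normrE.
  apply: le_trans; last exact: (le_bigmax _ _ (ord0, j)).
  by rewrite !mxE.
- move=> y /= /existsNP[j Hj]; rewrite (bigD1 j)//= plateau_eq0 ?mul0r//.
  rewrite normrM normfV (gtr0_norm d0) ler_pdivlMr// mul1r leNgt.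
  apply/negP => H; apply: Hj; rewrite /= in_itv /=.
  by move: H; rewrite ltr_norml => /andP[? ?]; apply/andP; split; lra.
- by apply: (@rV_compact _ _ (fun j => `[x ord0 j - d, x ord0 j + d]%classic)) => j; exact: segment_compact.
- move=> y /= Hy; apply: He; rewrite -ball_normE /=.
  rewrite /Num.Def.normr/= mx_normrE; apply/bigmax_ltP; split=> // -[i j] _ /=.
  rewrite !mxE /= (ord1 i); have := Hy j; rewrite /= in_itv /= => /andP[? ?].
  have de : d < e by rewrite /d; lra.
  by rewrite ltr_norml; apply/andP; split; lra.
Qed.

End Bump.

(** * Real functions on a manifold *)

Section Charts.
Variables (R : realType) (m : nat) (M : smoothManifold R m).
Implicit Types (c : chart R m M) (U V : set M) (p q : M) (x : 'rV[R]_m).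
Implicit Types (f g : M -> R).

Lemma coord_in_range c p : dom c p -> (coord c @` dom c) (coord c p).
Proof. by move=> cp; exists p. Qed.

Lemma coord_continuous_at c p : dom c p -> {for p, continuous (coord c)}.
Proof.
move=> cp; have := coord_cont (c := c).
by rewrite continuous_open_subspace; [apply; rewrite inE | exact: dom_open].
Qed.

Lemma coord_inv_continuous_at c p : dom c p ->
  {for coord c p, continuous (coord_inv c)}.
Proof.
move=> cp; have := coord_inv_cont (c := c).
rewrite continuous_open_subspace; last exact: range_open.
by apply; rewrite inE; exact: coord_in_range.
Qed.

Lemma near_coord_inv c p (P : M -> Prop) : dom c p ->
  (\forall q \near p, P q) -> \forall x \near coord c p, P (coord_inv c x).
Proof.
move=> cp HP; have := coord_inv_continuous_at cp.
by rewrite /prop_for /continuous_at coordK//; apply.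
Qed.

Lemma near_coord c p (P : 'rV[R]_m -> Prop) : dom c p ->
  (\forall x \near coord c p, P x) -> \forall q \near p, P (coord c q).
Proof. by move=> cp; exact: (coord_continuous_at cp). Qed.

Lemma near_dom c p : dom c p -> \forall q \near p, dom c q.
Proof. by move=> cp; apply: open_nbhs_nbhs; split=> //; exact: dom_open. Qed.

Lemma near_coord_invK c p : dom c p ->
  \forall x \near coord c p, coord c (coord_inv c x) = x.
Proof.
move=> cp; have : \forall x \near coord c p, (coord c @` dom c) x.
  apply: open_nbhs_nbhs; split; [exact: range_open|exact: coord_in_range].
by apply: filterS => _ [q cq <-]; rewrite coordK.
Qed.

Lemma coord_image_open c U : open U -> open (coord c @` (dom c `&` U)).
Proof.
move=> oU; rewrite openE => _ [p [cp Up] <-]; rewrite /interior.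
have H1 := near_coord_inv cp (near_dom cp).
have H2 := near_coord_inv cp (open_nbhs_nbhs (conj oU Up)).
apply: filterS3 H1 H2 (near_coord_invK cp) => x h1 h2 h3.
by exists (coord_inv c x).
Qed.

Lemma atlas_smooth_chart c : atlas c -> smooth_chart c.
Proof. by move=> Ac c' Ac'; exact: atlas_compatible. Qed.

Lemma exists_smooth_chart p : exists2 c, smooth_chart c & dom c p.
Proof.
by have [c Ac cp] := atlas_cover p; exists c => //; exact: atlas_smooth_chart.
Qed.

(** Charts of the maximal atlas are only required to be compatible with the
    atlas; around each point the transition factors through a chart of it. *)
Lemma smooth_chart_transition c c' : smooth_chart c -> smooth_chart c' ->
  smooth_transition c c'.
Proof.
move=> Hc Hc' j k; apply/Ck_pointwise => _ [p [cp c'p] <-].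
have [a Aa ap] := atlas_cover p.
pose V := coord c @` (dom c `&` (dom a `&` dom c')).
have oV : open V by apply: coord_image_open; apply: openI; exact: dom_open.
have Vp : V (coord c p) by exists p.
have oW : open (coord a @` (dom a `&` dom c')) by apply: coord_image_open; exact: dom_open.
apply: (Ck_pointwise _ _ _).1 Vp.
apply: (Ck_eq oV _ (Ck_comp (u := coord a \o coord_inv c) oV oW _ _
  ((Hc' _ Aa).2 j k))).
- by move=> _ [q [cq [aq c'q]] <-] /=; rewrite !coordK.
- by move=> _ [q [cq [aq c'q]] <-] /=; rewrite coordK//; exists q.
- move=> i; apply: Ck_sub ((Hc _ Aa).1 i k).
  by move=> _ [q [cq [aq c'q]] <-] /=; exists q.
Qed.

(** A single chart suffices, as the transitions to the other charts are
    smooth. *)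
Lemma smoothR_chart c U f : smooth_chart c -> open U -> U `<=` dom c ->
  Cinfty (coord c @` U) (f \o coord_inv c) -> smoothR U f.
Proof.
move=> Hc oU Uc Hf c' Hc' k.
have oV : open (coord c' @` (dom c' `&` U)) by exact: coord_image_open.
have E : coord c @` U = coord c @` (dom c `&` U) by rewrite setIC setIidl.
have oW : open (coord c @` U) by rewrite E; exact: coord_image_open.
apply: (Ck_eq oV _ (Ck_comp (u := coord c \o coord_inv c') oV oW _ _ (Hf k))).
- by move=> _ [q [c'q Uq] <-] /=; rewrite !coordK//; exact: Uc.
- by move=> _ [q [c'q Uq] <-] /=; rewrite coordK//; exists q.
- move=> i; apply: Ck_sub (smooth_chart_transition Hc' Hc i k).
  by move=> _ [q [c'q Uq] <-] /=; exists q => //; split=> //; exact: Uc.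
Qed.

Lemma smoothR_local U f :
  (forall p, U p -> exists V, [/\ V p & smoothR V f]) -> smoothR U f.
Proof.
move=> H c Hc k; apply/Ck_pointwise => _ [p [cp Up] <-].
have [V [Vp Hf]] := H _ Up.
by apply: (Ck_pointwise _ _ _).1 (Hf c Hc k) _ _; exists p.
Qed.

Lemma smoothR_sub U V f : U `<=` V -> smoothR V f -> smoothR U f.
Proof. by move=> UV Hf; apply: smoothR_local => p /UV Vp; exists V. Qed.

Lemma smoothR_eq U f g : open U -> (forall p, U p -> f p = g p) ->
  smoothR U f -> smoothR U g.
Proof.
move=> oU fg Hf c Hc k; apply: Ck_eq (Hf c Hc k).
  exact: coord_image_open.
by move=> _ [p [cp Up] <-] /=; rewrite coordK// fg.
Qed.

Lemma smoothR_cst U (a : R) : smoothR U (fun=> a).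
Proof. by move=> c Hc k; exact: Ck_cst. Qed.

Lemma smoothRD U f g : open U -> smoothR U f -> smoothR U g ->
  smoothR U (fun p => f p + g p).
Proof.
move=> oU Hf Hg c Hc k.
exact: (CkD (coord_image_open oU) (Hf c Hc k) (Hg c Hc k)).
Qed.

Lemma smoothRM U f g : open U -> smoothR U f -> smoothR U g ->
  smoothR U (fun p => f p * g p).
Proof.
move=> oU Hf Hg c Hc k.
exact: (CkM (coord_image_open oU) (Hf c Hc k) (Hg c Hc k)).
Qed.

Lemma smoothRN U f : open U -> smoothR U f -> smoothR U (fun p => - f p).
Proof.
move=> oU Hf; apply: (@smoothR_eq _ (fun p => -1 * f p)) => //.
  by move=> p _; rewrite mulN1r.
by apply: smoothRM => //; exact: smoothR_cst.
Qed.

Lemma smoothR_coord c (j : 'I_m) : smooth_chart c ->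
  smoothR (dom c) (fun q => coord c q ord0 j).
Proof.
move=> Hc; apply: (smoothR_chart Hc (dom_open c)) => // k.
apply: Ck_eq (Ck_coord _ _ j); first exact: range_open.
by move=> _ [q cq <-] /=; rewrite coordK.
Qed.

Lemma smoothR_differentiable c U f p : smooth_chart c -> dom c p -> U p ->
  smoothR U f -> differentiable (f \o coord_inv c) (coord c p).
Proof. by move=> Hc cp Up Hf; apply: (Hf c Hc 1%N).1; exists p. Qed.

Lemma partialR_near c j p f g : dom c p -> (\forall q \near p, f q = g q) ->
  partialR c j f p = partialR c j g p.
Proof.
by move=> cp fg; apply: near_eq_derive; exact: (near_coord_inv cp fg).
Qed.

Lemma partialR_cst c j (a : R) p : partialR c j (fun=> a) p = 0.
Proof. exact: derive_cst. Qed.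

Lemma partialRD c j U f g p : smooth_chart c -> dom c p -> U p ->
  smoothR U f -> smoothR U g ->
  partialR c j (fun q => f q + g q) p = partialR c j f p + partialR c j g p.
Proof.
move=> Hc cp Up Hf Hg; apply: deriveD; apply: diff_derivable;
  exact: smoothR_differentiable Hc cp Up _.
Qed.

Lemma partialRM c j U f g p : smooth_chart c -> dom c p -> U p ->
  smoothR U f -> smoothR U g ->
  partialR c j (fun q => f q * g q) p
  = f p * partialR c j g p + g p * partialR c j f p.
Proof.
move=> Hc cp Up Hf Hg; rewrite -{2 4}(coordK cp); apply: deriveM;
  apply: diff_derivable; exact: smoothR_differentiable Hc cp Up _.
Qed.

Lemma partialRN c j U f p : smooth_chart c -> dom c p -> U p ->
  smoothR U f -> partialR c j (fun q => - f q) p = - partialR c j f p.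
Proof.
move=> Hc cp Up Hf; apply: deriveN; apply: diff_derivable.
exact: smoothR_differentiable Hc cp Up _.
Qed.

Lemma partialR_coord c i j p : dom c p ->
  partialR c i (fun q => coord c q ord0 j) p = (i == j)%:R.
Proof.
move=> cp; transitivity ('D_(delta_mx ord0 i) (fun x : 'rV[R]_m => x ord0 j) (coord c p)).
  apply: near_eq_derive; apply: filterS (near_coord_invK cp) => x /= ->//.
have := derive_mx (@derivable_id R _ (coord c p) (delta_mx ord0 i)).
by rewrite derive_id => /matrixP /(_ ord0 j); rewrite !mxE eqxx eq_sym.
Qed.

Lemma smoothR_partialR c j U f : smooth_chart c -> open U -> U `<=` dom c ->
  smoothR U f -> smoothR U (partialR c j f).
Proof.
move=> Hc oU Uc Hf; apply: (smoothR_chart Hc oU Uc) => k.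
have E : coord c @` U = coord c @` (dom c `&` U) by rewrite setIC setIidl.
have oW : open (coord c @` U) by rewrite E; exact: coord_image_open.
have := (Hf c Hc k.+1).2 (delta_mx ord0 j); rewrite -E.
apply: Ck_eq oW _.
by move=> _ [q Uq <-] /=; rewrite coordK//; exact: Uc.
Qed.

Lemma partialRC c i j U f p : smooth_chart c -> open U -> U `<=` dom c -> U p ->
  smoothR U f ->
  partialR c i (partialR c j f) p = partialR c j (partialR c i f) p.
Proof.
move=> Hc oU Uc Up Hf; have cp := Uc _ Up.
have E i' j' : partialR c i' (partialR c j' f) p =
    'D_(delta_mx ord0 i') ('D_(delta_mx ord0 j') (f \o coord_inv c)) (coord c p).
  apply: near_eq_derive; apply: filterS (near_coord_invK cp) => x /= xK.
  by rewrite /partialR xK.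
rewrite !E; apply: derive_swap (Hf c Hc 2%N); first exact: coord_image_open.
by exists p.
Qed.

End Charts.

(** * Global extension and complex functions *)

(** Cut off with a bump function in a chart.  The compact support is closed
    because the manifold is Hausdorff; so every point outside of the chart has a
    neighbourhood on which the extension by zero vanishes. *)
Lemma exists_globalR (R : realType) m (M : smoothManifold R m) (U : set M)
    (f : M -> R) p : open U -> U p -> smoothR U f ->
  exists F : M -> R, smoothR setT F /\ \forall q \near p, F q = f q.
Proof.
move=> oU Up Hf; have [c Hc cp] := exists_smooth_chart p.
set V := dom c `&` U; have oV : open V by apply: openI => //; exact: dom_open.
have Vp : (coord c @` V) (coord c p) by exists p.
have [b [K [Hb b1 b0 cK KV]]] := exists_bump (coord_image_open (c := c) oU) Vp.
pose F q := if `[<V q>] then b (coord c q) * f q else 0.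
exists F; split; last first.
  have nV : \forall q \near p, V q by apply: open_nbhs_nbhs; split.
  apply: filterS2 nV (near_coord cp b1) => q Vq b1q.
  by rewrite /F asboolT// b1q mul1r.
have clK : closed (coord_inv c @` K).
  apply: compact_closed; first exact: manifold_hausdorff.
  apply: continuous_compact => //; apply: continuous_in_subspaceT => x.
  by rewrite inE => /KV [q [cq _] <-]; exact: coord_inv_continuous_at.
apply: smoothR_local => q _; have [Vq|nVq] := pselect (V q).
  exists V; split=> //.
  apply: (@smoothR_eq _ _ _ _ (fun q => b (coord c q) * f q)) => //.
    by move=> r Vr; rewrite /F asboolT.
  apply: smoothRM => //; last by apply: smoothR_sub Hf => r [].
  apply: (smoothR_chart Hc oV) => [r []//|k].
  apply: (@Ck_eq _ _ _ _ b); first by have := coord_image_open (c := c) oU.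
    by move=> _ [r [cr _] <-] /=; rewrite coordK.
  by apply: Ck_sub (Hb k).
exists (~` (coord_inv c @` K)); split.
  by move=> [x Kx xq]; have [r Vr rx] := KV _ Kx; apply: nVq; rewrite -xq -rx coordK//; case: Vr.
apply: (@smoothR_eq _ _ _ _ (fun=> 0)); first by apply: closed_openC.
  move=> r Hr; rewrite /F; case: asboolP => // -[cr Ur].
  rewrite b0 ?mul0r// => Kr; apply: Hr; exists (coord c r) => //.
  by rewrite coordK.
exact: smoothR_cst.
Qed.

Section ComplexFunctions.
Variables (R : realType) (m : nat) (M : smoothManifold R m).
Implicit Types (c : chart R m M) (U V : set M) (p q : M) (f g : M -> R[i]).

Lemma complexEta (z : R[i]) : z = Complex (complex.Re z) (complex.Im z).
Proof. by case: z. Qed.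

Lemma ReD (x y : R[i]) : complex.Re (x + y) = complex.Re x + complex.Re y.
Proof. by case: x; case: y. Qed.

Lemma ImD (x y : R[i]) : complex.Im (x + y) = complex.Im x + complex.Im y.
Proof. by case: x; case: y. Qed.

Lemma ReM (x y : R[i]) :
  complex.Re (x * y) = complex.Re x * complex.Re y + - (complex.Im x * complex.Im y).
Proof. by case: x; case: y. Qed.

Lemma ImM (x y : R[i]) :
  complex.Im (x * y) = complex.Re x * complex.Im y + complex.Im x * complex.Re y.
Proof. by case: x; case: y. Qed.

Lemma smooth_sub U V f : U `<=` V -> smooth V f -> smooth U f.
Proof. by move=> UV [f1 f2]; split; apply: smoothR_sub UV _. Qed.

Lemma smooth_cst U (a : R[i]) : smooth U (fun=> a).
Proof. by split; exact: smoothR_cst. Qed.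

Lemma smoothD U f g : open U -> smooth U f -> smooth U g ->
  smooth U (fun p => f p + g p).
Proof.
move=> oU [f1 f2] [g1 g2]; split.
  by under eq_fun do rewrite ReD; exact: smoothRD.
by under eq_fun do rewrite ImD; exact: smoothRD.
Qed.

Lemma smoothM U f g : open U -> smooth U f -> smooth U g ->
  smooth U (fun p => f p * g p).
Proof.
move=> oU [f1 f2] [g1 g2]; split.
  under eq_fun do rewrite ReM.
  by apply: smoothRD => //; [exact: smoothRM|apply: smoothRN => //; exact: smoothRM].
by under eq_fun do rewrite ImM; apply: smoothRD => //; exact: smoothRM.
Qed.

Lemma smooth_sum U n (F : 'I_n -> M -> R[i]) : open U ->
  (forall i, smooth U (F i)) -> smooth U (fun p => \sum_i F i p).
Proof.
move=> oU; elim: n F => [|n IH] F HF.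
  rewrite (_ : (fun p => _) = fun=> 0); first exact: smooth_cst.
  by apply/funext => p; rewrite big_ord0.
rewrite (_ : (fun p => _) = fun p => F ord0 p + \sum_(i < n) F (lift ord0 i) p).
  by apply: smoothD => //; exact: IH.
by apply/funext => p; rewrite big_ord_recl.
Qed.

Lemma smooth_real U (f : M -> R) : smoothR U f -> smooth U (fun p => (f p)%:C%C).
Proof. by move=> Hf; split=> //=; exact: smoothR_cst. Qed.

Lemma exists_global U f p : open U -> U p -> smooth U f ->
  exists F : M -> R[i], smooth setT F /\ \forall q \near p, F q = f q.
Proof.
move=> oU Up [f1 f2].
have [F1 [F1s E1]] := exists_globalR oU Up f1.
have [F2 [F2s E2]] := exists_globalR oU Up f2.
exists (fun q => Complex (F1 q) (F2 q)); split; first by split.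
by apply: filterS2 E1 E2 => q -> ->; rewrite [RHS]complexEta.
Qed.

Lemma partial_near c j p f g : dom c p -> (\forall q \near p, f q = g q) ->
  partial c j f p = partial c j g p.
Proof.
by move=> cp fg; congr Complex; apply: partialR_near => //; apply: filterS fg => q ->.
Qed.

Lemma partial_near2 c j p f g : dom c p -> (\forall q \near p, f q = g q) ->
  \forall q \near p, partial c j f q = partial c j g q.
Proof.
move=> cp /near_join fg; apply: filterS2 (near_dom cp) fg => q cq fgq.
exact: partial_near.
Qed.

Lemma partial_cst c j (a : R[i]) p : partial c j (fun=> a) p = 0.
Proof. by rewrite /partial !partialR_cst. Qed.

Lemma partialD c j U f g p : smooth_chart c -> dom c p -> U p ->
  smooth U f -> smooth U g ->
  partial c j (fun q => f q + g q) p = partial c j f p + partial c j g p.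
Proof.
move=> Hc cp Up [f1 f2] [g1 g2]; rewrite /partial.
under eq_fun do rewrite ReD; under [X in Complex _ (_ X _)]eq_fun do rewrite ImD.
by rewrite (partialRD _ Hc cp Up f1 g1) (partialRD _ Hc cp Up f2 g2).
Qed.

Lemma partialM c j U f g p : open U -> smooth_chart c -> dom c p -> U p ->
  smooth U f -> smooth U g ->
  partial c j (fun q => f q * g q) p
  = partial c j f p * g p + f p * partial c j g p.
Proof.
move=> oU Hc cp Up [f1 f2] [g1 g2]; rewrite /partial.
under eq_fun do rewrite ReM; under [X in Complex _ (_ X _)]eq_fun do rewrite ImM.
rewrite (partialRD _ Hc cp Up (smoothRM oU f1 g1) (smoothRN oU (smoothRM oU f2 g2))).
rewrite (partialRN _ Hc cp Up (smoothRM oU f2 g2)).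
rewrite (partialRD _ Hc cp Up (smoothRM oU f1 g2) (smoothRM oU f2 g1)).
rewrite (partialRM _ Hc cp Up f1 g1) (partialRM _ Hc cp Up f2 g2).
rewrite (partialRM _ Hc cp Up f1 g2) (partialRM _ Hc cp Up f2 g1).
case: (f p) (g p) => [a b] [a' b'].
by apply/eqP; rewrite eq_complex /=; apply/andP; split; apply/eqP => /=; ring.
Qed.

Lemma partialMl c j (a : R[i]) U f p : open U -> smooth_chart c -> dom c p -> U p ->
  smooth U f -> partial c j (fun q => a * f q) p = a * partial c j f p.
Proof.
move=> oU Hc cp Up Hf.
by rewrite (partialM j oU Hc cp Up (smooth_cst U a) Hf) partial_cst mul0r add0r.
Qed.

Lemma partial_sum c j U n (F : 'I_n -> M -> R[i]) p :
  open U -> smooth_chart c -> dom c p -> U p -> (forall i, smooth U (F i)) ->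
  partial c j (fun q => \sum_i F i q) p = \sum_i partial c j (F i) p.
Proof.
move=> oU Hc cp Up; elim: n F => [|n IH] F HF.
  rewrite big_ord0 -[RHS](partial_cst c j 0 p); congr partial.
  by apply/funext => q; rewrite big_ord0.
rewrite big_ord_recl -IH; last by move=> i; exact: HF.
rewrite -(partialD j Hc cp Up (HF _) (smooth_sum oU (fun i => HF (lift ord0 i)))).
by congr partial; apply/funext => q; rewrite big_ord_recl.
Qed.

Lemma smooth_partial c j U f : smooth_chart c -> open U -> U `<=` dom c ->
  smooth U f -> smooth U (partial c j f).
Proof. by move=> Hc oU Uc [f1 f2]; split; exact: smoothR_partialR. Qed.

Lemma partialC c i j U f p : smooth_chart c -> open U -> U `<=` dom c -> U p ->
  smooth U f -> partial c i (partial c j f) p = partial c j (partial c i f) p.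
Proof.
move=> Hc oU Uc Up [f1 f2].
exact: (f_equal2 (@Complex R) (partialRC i j Hc oU Uc Up f1)
                              (partialRC i j Hc oU Uc Up f2)).
Qed.

Lemma extension_smooth p f : smooth setT (extension p f).
Proof. by rewrite /extension; case: xgetP => [F _ []//|_]; exact: smooth_cst. Qed.

Lemma extension_near U f p : open U -> U p -> smooth U f ->
  \forall q \near p, extension p f q = f q.
Proof.
move=> oU Up /(exists_global oU Up) [F HF].
by rewrite /extension; case: xgetP => [G _ []//|] /(_ F).
Qed.

End ComplexFunctions.

(** * Order of vanishing and functionals on jets *)

Section Vanishing.
Variables (R : realType) (m : nat) (M : smoothManifold R m).
Variables (c : chart R m M) (p : M).
Hypotheses (Hc : smooth_chart c) (cp : dom c p).
Implicit Types (f g h : M -> R[i]) (k a b : nat).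

(** Derivatives are peeled off one at a time, in any order: this allows
    inductions on the order of vanishing without multi-indices. *)
Fixpoint vanish k f : Prop :=
  match k with
  | 0%N => True
  | k'.+1 => f p = 0 /\ forall j, vanish k' (partial c j f)
  end.

Let odom : open (dom c). Proof. exact: dom_open. Qed.

Let smooth_dpartial j f : smooth (dom c) f -> smooth (dom c) (partial c j f).
Proof. by move=> Hf; apply: smooth_partial. Qed.

Lemma vanish_near k f g : (\forall q \near p, f q = g q) -> vanish k f -> vanish k g.
Proof.
elim: k f g => //= k IH f g fg [f0 f1]; split=> [|j].
  by rewrite -f0; apply/esym; exact: (nbhs_singleton fg).
by apply: IH (f1 j); exact: partial_near2.
Qed.

Lemma vanish_eq k f g : (forall q, dom c q -> f q = g q) -> vanish k f -> vanish k g.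
Proof.
by move=> fg; apply: vanish_near; apply: filterS (near_dom cp); exact: fg.
Qed.

Lemma vanish_pred k f : vanish k.+1 f -> vanish k f.
Proof.
elim: k f => //= k IH f [f0 f1]; split=> // j; apply: IH; exact: f1.
Qed.

Lemma vanish_le a b f : (a <= b)%N -> vanish b f -> vanish a f.
Proof.
by move/subnK <-; elim: (b - a)%N => [|d IH] // /vanish_pred; exact: IH.
Qed.

Lemma vanish0 k : vanish k (fun=> 0).
Proof.
elim: k => //= k IH; split=> // j.
by rewrite (_ : partial _ _ _ = fun=> 0)//; apply/funext => q; rewrite partial_cst.
Qed.

Lemma vanishD k f g : smooth (dom c) f -> smooth (dom c) g ->
  vanish k f -> vanish k g -> vanish k (fun q => f q + g q).
Proof.
elim: k f g => //= k IH f g sf sg [f0 f1] [g0 g1]; split=> [|j].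
  by rewrite f0 g0 addr0.
apply: (@vanish_eq _ (fun q => partial c j f q + partial c j g q)).
  by move=> q cq; rewrite (partialD j Hc cq cq sf sg).
by apply: IH; do ?exact: smooth_dpartial.
Qed.

Lemma vanish_sum k n (F : 'I_n -> M -> R[i]) :
  (forall i, smooth (dom c) (F i)) -> (forall i, vanish k (F i)) ->
  vanish k (fun q => \sum_i F i q).
Proof.
elim: n F => [|n IH] F sF vF.
  by apply: vanish_eq (vanish0 k) => q _; rewrite big_ord0.
apply: (@vanish_eq _ (fun q => F ord0 q + \sum_(i < n) F (lift ord0 i) q)).
  by move=> q _; rewrite big_ord_recl.
by apply: vanishD => //; [exact: smooth_sum|exact: IH].
Qed.

Lemma vanishM a b f g : smooth (dom c) f -> smooth (dom c) g ->
  vanish a f -> vanish b g -> vanish (a + b) (fun q => f q * g q).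
Proof.
suff H k : forall a b f g, (a + b)%N = k -> smooth (dom c) f -> smooth (dom c) g ->
    vanish a f -> vanish b g -> vanish k (fun q => f q * g q) by exact: H.
elim: k {a b f g} => //= k IH a b f g abk sf sg vf vg; split=> [|j].
  case: a abk vf => [|a] abk; last by case=> -> _; rewrite mul0r.
  by case: b abk vg => // b _ [-> _]; rewrite mulr0.
apply: (@vanish_eq _ (fun q => partial c j f q * g q + f q * partial c j g q)).
  by move=> q cq; rewrite (partialM j odom Hc cq cq sf sg).
have sf' := smooth_dpartial j sf; have sg' := smooth_dpartial j sg.
apply: vanishD; do ?by apply: smoothM.
  case: a abk vf => [|a] abk vf.
    case: b abk vg => // b abk /vanish_pred vg.
    by apply: (IH 0%N b) => //; lia.
  by apply: (IH a b) => //; [lia | exact: vf.2].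
case: b abk vg => [|b] abk vg.
  case: a abk vf => // a abk /vanish_pred vf.
  by apply: (IH a 0%N) => //; lia.
by apply: (IH a b) => //; [lia | exact: vg.2].
Qed.

Definition shifted_coord (i : 'I_m) (q : M) : R[i] :=
  (coord c q ord0 i - coord c p ord0 i)%:C%C.

Lemma smooth_shifted_coord i : smooth (dom c) (shifted_coord i).
Proof.
apply: smooth_real; apply: smoothRD => //; first exact: smoothR_coord.
exact: smoothR_cst.
Qed.

Lemma partial_shifted_coord i j q : dom c q ->
  partial c i (shifted_coord j) q = (i == j)%:R.
Proof.
move=> cq; rewrite /partial /shifted_coord /= partialR_cst.
rewrite (partialRD i Hc cq cq (smoothR_coord j Hc) (smoothR_cst _ _)).
by rewrite partialR_coord// partialR_cst addr0; case: eqP.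
Qed.

(** Modulo functions vanishing to a higher order, [f] is a homogeneous
    polynomial of degree [k], and this is Euler's identity for it.  The proof by
    induction uses that [d_j] and the Euler operator commute up to [d_j]. *)
Lemma vanish_euler k f : smooth (dom c) f -> vanish k f ->
  vanish k.+1 (fun q => \sum_i shifted_coord i q * partial c i f q + - k%:R * f q).
Proof.
elim: k f => [|k IH] f sf vf.
  split=> //; rewrite mulNr mul0r oppr0 addr0 big1// => i _.
  by rewrite /shifted_coord subrr mul0r.
split=> [|j].
  case: vf => -> _; rewrite mulr0 addr0 big1// => i _.
  by rewrite /shifted_coord subrr mul0r.
apply: (@vanish_eq _ (fun q => \sum_i shifted_coord i q * partial c i (partial c j f) q
                      + - k%:R * partial c j f q)); last first.
  by apply: IH; [exact: smooth_dpartial|exact: vf.2].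
move=> q cq.
have sx i : smooth (dom c) (fun q => shifted_coord i q * partial c i f q).
  by apply: smoothM => //; [exact: smooth_shifted_coord|exact: smooth_dpartial].
rewrite (partialD j Hc cq cq (smooth_sum odom sx) (smoothM odom (smooth_cst _ _) sf)).
rewrite (partialMl j _ odom Hc cq cq sf) (partial_sum j odom Hc cq cq sx).
rewrite [X in _ = X + _](_ : _ = \sum_i ((j == i)%:R * partial c i f q +
    shifted_coord i q * partial c i (partial c j f) q)); last first.
  apply: eq_bigr => i _.
  rewrite (partialM j odom Hc cq cq (smooth_shifted_coord i) (smooth_dpartial i sf)).
  by rewrite (partial_shifted_coord j i cq) (partialC j i Hc odom (fun _ => id) cq sf).
rewrite big_split /= [X in _ = X + _ + _](bigD1 j)//= eqxx mul1r [X in _ = _ + X + _ + _]big1 ?addr0; last first.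
  by move=> i ij; rewrite eq_sym (negbTE ij) mul0r.
by rewrite -natr1; ring.
Qed.

Lemma smoothT_dom f : smooth setT f -> smooth (dom c) f.
Proof. exact: smooth_sub. Qed.

Section Functional.
Variables (L : (M -> R[i]) -> R[i]) (N : nat) (w : 'I_m -> M -> R[i]).
Hypothesis LD : forall f g, smooth setT f -> smooth setT g ->
  L (fun q => f q + g q) = L f + L g.
Hypothesis LZ : forall (z : R[i]) f, smooth setT f ->
  L (fun q => z * f q) = z * L f.
Hypothesis L1 : L (fun=> 1) = 0.
Hypothesis LN : forall f, smooth setT f -> vanish N f -> L f = 0.
Hypothesis sw : forall j, smooth setT (w j).
Hypothesis Lw : forall j f, smooth setT f -> L (fun q => w j q * f q) = w j p * L f.
Hypothesis w_unit : (\matrix_(i, j) partial c i (w j) p) \in unitmx.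

Let oT : open [set: M]. Proof. exact: openT. Qed.

Let L_sum n (F : 'I_n -> M -> R[i]) : (forall i, smooth setT (F i)) ->
  L (fun q => \sum_i F i q) = \sum_i L (F i).
Proof.
elim: n F => [|n IH] F sF.
  rewrite big_ord0 LN//.
    by apply: smooth_sum.
  by apply: vanish_eq (vanish0 N) => q _; rewrite big_ord0.
rewrite big_ord_recl -IH// -LD//; last exact: smooth_sum.
by congr L; apply/funext => q; rewrite big_ord_recl.
Qed.

Let centered j (q : M) : R[i] := w j q + - w j p.

Let s_centered j : smooth setT (centered j).
Proof. by apply: smoothD => //; exact: smooth_cst. Qed.

Let L_centered j f : smooth setT f -> L (fun q => centered j q * f q) = 0.
Proof.
move=> sf; rewrite /centered.
under eq_fun do rewrite mulrDl.
rewrite LD ?Lw ?LZ//; [by rewrite mulNr subrr|exact: smoothM|].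
by apply: smoothM => //; exact: smooth_cst.
Qed.

(** With [A] the inverse of the Jacobian matrix of the [w j], the combinations
    [y i] agree with the coordinates up to order two.  So [k.+1 f] may be
    replaced by [h], a combination of multiples of the [centered j]. *)
Let functional_step k : (forall f, smooth setT f -> vanish k.+2 f -> L f = 0) ->
  forall f, smooth setT f -> vanish k.+1 f -> L f = 0.
Proof.
move=> IH f sf vf; have sf' := smoothT_dom sf.
pose W := (\matrix_(i, j) partial c i (w j) p) : 'M[R[i]]_m; pose A := invmx W.
have /choice [g gP] : forall i, exists g, smooth setT g /\
    \forall q \near p, g q = partial c i f q.
  by move=> i; apply: (exists_global odom cp); exact: smooth_dpartial.
pose y i q := \sum_j A j i * centered j q.
have sy i : smooth setT (y i).
  by apply: smooth_sum => // j; apply: smoothM => //; exact: smooth_cst.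
pose h q := \sum_i y i q * g i q.
have sh : smooth setT h.
  by apply: smooth_sum => // i; apply: smoothM => //; exact: (gP i).1.
have Lh : L h = 0.
  rewrite /h L_sum; last by move=> i; apply: smoothM => //; exact: (gP i).1.
  rewrite big1// => i _; rewrite /y.
  under eq_fun do rewrite mulr_suml.
  rewrite L_sum; last first.
    move=> j; apply: smoothM => //; last exact: (gP i).1.
    by apply: smoothM => //; exact: smooth_cst.
  rewrite big1// => j _; under eq_fun do rewrite -mulrA.
  rewrite LZ; last by apply: smoothM => //; exact: (gP i).1.
  by rewrite L_centered ?mulr0//; exact: (gP i).1.
have vy i : vanish 2 (fun q => y i q + - 1 * shifted_coord i q).
  have sy' := smoothT_dom (sy i); have sx := smooth_shifted_coord i.
  have sx' := smoothM odom (smooth_cst _ (-1)) sx.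
  split=> [|l].
    rewrite /y /shifted_coord subrr mulr0 addr0 big1// => j _.
    by rewrite /centered subrr mulr0.
  split=> //; rewrite (partialD l Hc cp cp sy' sx').
  rewrite (partialMl l _ odom Hc cp cp sx) partial_shifted_coord//.
  have sA j : smooth (dom c) (fun q => A j i * centered j q).
    by apply: smoothM => //; [exact: smooth_cst|exact: smoothT_dom].
  rewrite (partial_sum l odom Hc cp cp sA).
  rewrite (eq_bigr (fun j => W l j * A j i)); last first.
    move=> j _; rewrite (partialMl l _ odom Hc cp cp (smoothT_dom (s_centered j))).
    rewrite (partialD l Hc cp cp (smoothT_dom (sw j)) (smooth_cst _ _)).
    by rewrite partial_cst addr0 mulrC mxE.
  have := mulmxV w_unit; move/matrixP/(_ l i); rewrite !mxE => ->.
  by rewrite mulN1r subrr.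
have : L (fun q => h q + - k.+1%:R * f q) = 0.
  apply: IH; first by apply: smoothD => //; apply: smoothM => //; exact: smooth_cst.
  have sF i : smooth (dom c) (fun q => (y i q + - 1 * shifted_coord i q) * partial c i f q).
    apply: smoothM => //; last exact: smooth_dpartial.
    apply: smoothD => //; first exact: smoothT_dom.
    by apply: smoothM => //; [exact: smooth_cst|exact: smooth_shifted_coord].
  have vF i : vanish k.+2 (fun q => (y i q + - 1 * shifted_coord i q) * partial c i f q).
    apply: (@vanishM 2 k) => //; [|exact: smooth_dpartial|exact: vf.2].
    apply: smoothD => //; first exact: smoothT_dom.
    by apply: smoothM => //; [exact: smooth_cst|exact: smooth_shifted_coord].
  have H := vanishD _ (smooth_sum odom sF) (vanish_euler sf' vf) (vanish_sum sF vF).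
  have : vanish k.+2 (fun q => \sum_i shifted_coord i q * partial c i f q + - k.+1%:R * f q
      + \sum_i (y i q + - 1 * shifted_coord i q) * partial c i f q).
    apply: H; apply: smoothD => //.
      apply: smooth_sum => // i; apply: smoothM => //; last exact: smooth_dpartial.
      exact: smooth_shifted_coord.
    by apply: smoothM => //; exact: smooth_cst.
  apply: vanish_near.
  have : \forall q \near p, forall i, g i q = partial c i f q.
    by apply: filter_forall => i; exact: (gP i).2.
  apply: filterS => q gq; rewrite addrAC -big_split /=; congr (_ + _).
  by apply: eq_bigr => i _; rewrite gq; ring.
rewrite LD//; last by apply: smoothM => //; exact: smooth_cst.
rewrite Lh LZ// add0r => /eqP; rewrite mulf_eq0 oppr_eq0 pnatr_eq0 /=.
by move/eqP.
Qed.

(** By [functional_step], descending from the order [N], the functional kills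
    all functions vanishing at [p]; the value at [p] is carried by a constant. *)
Lemma functional_eq0 f : smooth setT f -> L f = 0.
Proof.
move=> sf.
have H k g : smooth setT g -> vanish k.+1 g -> L g = 0.
  have [d] := ubnP (N - k)%N; elim: d k g => // d IH k g Nk sg vg.
  have [Nk'|kN] := leqP N k.+1; first by apply: LN => //; exact: vanish_le vg.
  apply: (functional_step (k := k)) => // g' sg' vg'.
  by apply: (IH k.+1) => //; lia.
rewrite (_ : f = (fun q => (f q + - f p) + f p * 1)); last first.
  by apply/funext => q; rewrite mulr1 subrK.
have s1 : smooth setT (fun q => f q + - f p) by apply: smoothD => //; exact: smooth_cst.
rewrite LD//; last by apply: smoothM => //; exact: smooth_cst.
rewrite LZ ?L1 ?mulr0 ?addr0; last exact: smooth_cst.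
by apply: (H 0%N) => //; split=> //; rewrite subrr.
Qed.

End Functional.
End Vanishing.

(** * Bidifferential operators *)

Section Bidifferential.
Variables (R : realType) (m : nat) (M : smoothManifold R m).
Implicit Types (c : chart R m M) (p q : M) (f g h : M -> R[i]).
Implicit Types (B : (M -> R[i]) -> (M -> R[i]) -> M -> R[i]).

Section Partials.
Variables (c : chart R m M) (p : M) (N : nat) (alpha : {ffun 'I_m -> 'I_N.+1}).
Hypotheses (Hc : smooth_chart c) (cp : dom c p).

Lemma vanish_iter k d j f :
  vanish c p (k + d) f -> vanish c p k (iter d (partial c j) f).
Proof.
elim: d f => [|d IH] f; first by rewrite addn0.
by rewrite addnS iterSr => -[_ vf]; exact/IH/vf.
Qed.

Lemma vanish_partials f : vanish c p (N * m).+1 f -> partials c alpha f p = 0.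
Proof.
have H (s : seq 'I_m) k : vanish c p (k + N * size s) f ->
    vanish c p k (foldr (fun j F => iter (alpha j) (partial c j) F) f s).
  elim: s k => [|j s IH] k; first by rewrite muln0 addn0.
  rewrite /= mulnS addnA => /IH vF; apply: vanish_iter.
  by apply: vanish_le vF; rewrite leq_add2l -ltnS.
by move=> vf; have [] := H (enum 'I_m) 1%N; rewrite ?size_enum_ord ?add1n.
Qed.

(** Linearity is carried through the iteration together with smoothness, which
    each further derivative requires. *)
Lemma partials_lin (z : R[i]) f g q : dom c q ->
  smooth (dom c) f -> smooth (dom c) g ->
  partials c alpha (fun q => z * f q + g q) q
  = z * partials c alpha f q + partials c alpha g q.
Proof.
move=> cq sf sg.
have oc : open (dom c) by exact: dom_open.
pose rel F G H := [/\ smooth (dom c) F, smooth (dom c) G &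
  forall q, dom c q -> H q = z * F q + G q].
suff [_ _] : rel (partials c alpha f) (partials c alpha g)
    (partials c alpha (fun q => z * f q + g q)) by exact.
have step j F G H : rel F G H -> rel (partial c j F) (partial c j G) (partial c j H).
  move=> [sF sG E]; split; do ?exact: smooth_partial.
  move=> r cr; have sz := smoothM oc (smooth_cst _ z) sF.
  rewrite -(partialMl j z oc Hc cr cr sF) -(partialD j Hc cr cr sz sG).
  by apply: partial_near => //; apply: filterS (near_dom cr).
rewrite /partials; elim: (enum 'I_m) => [|j s IH] /=; first by split.
by elim: (nat_of_ord (alpha j)) => //= d; exact: step.
Qed.

End Partials.

Lemma bidifferential_at B c p : bidifferential B -> smooth_chart c -> dom c p ->
  exists (N : nat) (a : {ffun 'I_m -> 'I_N.+1} -> {ffun 'I_m -> 'I_N.+1} -> R[i]),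
  forall f h, smooth setT f -> smooth setT h -> B f h p =
    \sum_alpha \sum_beta a alpha beta * partials c alpha f p * partials c beta h p.
Proof.
move=> [_ HB] Hc cp; have [V [_ Vp _ [N [a [_ Ha]]]]] := HB _ _ Hc cp.
by exists N, (fun alpha beta => a alpha beta p) => f h sf sh; exact: Ha.
Qed.

(** Statements about the left argument are deduced from those about the right
    one. *)
Lemma bidifferential_flip B : bidifferential B -> bidifferential (fun f h => B h f).
Proof.
move=> [sB HB]; split=> [f h sf sh|c p Hc cp]; first exact: sB.
have [V [oV Vp Vc [N [a [sa Ha]]]]] := HB _ _ Hc cp.
exists V; split=> //; exists N, (fun alpha beta => a beta alpha); split=> //.
move=> f h sf sh q Vq; rewrite Ha// exchange_big /=.
by apply: eq_bigr => alpha _; apply: eq_bigr => beta _; rewrite mulrAC.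
Qed.

Lemma bidifferential_linr B (z : R[i]) f g h p : bidifferential B ->
  smooth setT f -> smooth setT g -> smooth setT h ->
  B f (fun q => z * g q + h q) p = z * B f g p + B f h p.
Proof.
move=> HB sf sg sh; have [c Hc cp] := exists_smooth_chart p.
have [N [a Ha]] := bidifferential_at HB Hc cp.
have oT : open [set: M] by exact: openT.
rewrite !Ha//; last first.
  by apply: smoothD => //; apply: smoothM => //; exact: smooth_cst.
rewrite mulr_sumr -big_split; apply: eq_bigr => alpha _ /=.
rewrite mulr_sumr -big_split; apply: eq_bigr => beta _ /=.
rewrite (partials_lin _ Hc z cp (smoothT_dom c sg) (smoothT_dom c sh)); ring.
Qed.

Lemma bidifferential0r B f : bidifferential B -> smooth setT f ->
  B f (fun=> 0) = fun=> 0.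
Proof.
move=> HB sf; apply/funext => p; have s0 := smooth_cst (M := M) setT 0.
have E := bidifferential_linr (-1) p HB sf s0 s0.
transitivity (-1 * B f (fun=> 0) p + B f (fun=> 0) p); last by rewrite mulN1r addNr.
by rewrite -E; congr (B f _ p); apply/funext => q; rewrite mulr0 addr0.
Qed.

Lemma bidifferential0l B f : bidifferential B -> smooth setT f ->
  B (fun=> 0) f = fun=> 0.
Proof.
by move=> /bidifferential_flip HB sf; exact: (bidifferential0r HB).
Qed.

Lemma bidifferential_vanishr B c p : bidifferential B -> smooth_chart c ->
  dom c p -> exists N, forall f h, smooth setT f -> smooth setT h ->
  vanish c p N h -> B f h p = 0.
Proof.
move=> HB Hc cp; have [N [a Ha]] := bidifferential_at HB Hc cp.
exists (N * m).+1 => f h sf sh vh; rewrite Ha// big1// => alpha _.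
by rewrite big1// => beta _; rewrite [partials c beta h p]vanish_partials// mulr0.
Qed.

(** The difference of two functions with the same germ vanishes to every
    order. *)
Lemma bidifferential_nearr B p f g h : bidifferential B ->
  smooth setT f -> smooth setT g -> smooth setT h ->
  (\forall q \near p, g q = h q) -> B f g p = B f h p.
Proof.
move=> HB sf sg sh gh; have [c Hc cp] := exists_smooth_chart p.
have [N HN] := bidifferential_vanishr HB Hc cp.
have oT : open [set: M] by exact: openT.
have sN : smooth setT (fun q => -1 * g q + h q).
  by apply: smoothD => //; apply: smoothM => //; exact: smooth_cst.
have : B f (fun q => -1 * g q + h q) p = 0.
  apply: HN => //; apply: (vanish_near cp) (vanish0 _ _ N).
  by apply: filterS gh => q ->; rewrite mulN1r addNr.
rewrite bidifferential_linr// mulN1r => /eqP; rewrite addrC subr_eq0.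
by move/eqP.
Qed.

Lemma bidifferential_nearl B p f g h : bidifferential B ->
  smooth setT f -> smooth setT g -> smooth setT h ->
  (\forall q \near p, f q = g q) -> B f h p = B g h p.
Proof.
move=> /bidifferential_flip HB sf sg sh; exact: (bidifferential_nearr HB sh sf sg).
Qed.

(** With one argument fixed, the difference of the two operators at [p] is a
    functional of finite order, to which [functional_eq0] applies. *)
Lemma bidifferential_eq_of_frame B B' c p f (w : 'I_m -> M -> R[i]) :
  bidifferential B -> bidifferential B' -> smooth_chart c -> dom c p ->
  smooth setT f -> (forall j, smooth setT (w j)) ->
  (\matrix_(i, j) partial c i (w j) p) \in unitmx ->
  B f (fun=> 1) p = B' f (fun=> 1) p ->
  (forall j h, smooth setT h ->
    B f (fun q => w j q * h q) p - B' f (fun q => w j q * h q) p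
    = w j p * (B f h p - B' f h p)) ->
  forall h, smooth setT h -> B f h p = B' f h p.
Proof.
move=> HB HB' Hc cp sf sw uw E1 Ew h sh.
have [N HN] := bidifferential_vanishr HB Hc cp.
have [N' HN'] := bidifferential_vanishr HB' Hc cp.
apply/eqP; rewrite -subr_eq0; apply/eqP.
apply: (@functional_eq0 R m M c p Hc cp (fun h => B f h p - B' f h p) (maxn N N') w) => //.
- move=> g g' sg sg'.
  have E : (fun q => g q + g' q) = (fun q => 1 * g q + g' q).
    by apply/funext => q; rewrite mul1r.
  rewrite E !bidifferential_linr//; ring.
- move=> z g sg.
  have E : (fun q => z * g q) = (fun q => z * g q + (fun=> 0) q).
    by apply/funext => q; rewrite addr0.
  have s0 := smooth_cst (M := M) setT 0.
  rewrite E !bidifferential_linr// !bidifferential0r//; ring.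
- by rewrite E1 subrr.
- move=> g sg vg; rewrite HN ?HN' ?subrr//.
    by apply: vanish_le vg; rewrite leq_maxr.
  by apply: vanish_le vg; rewrite leq_maxl.
Qed.

End Bidifferential.

Section StarProducts.
Variables (R : realType) (m : nat) (M : smoothManifold R m).
Implicit Types (C : nat -> (M -> R[i]) -> (M -> R[i]) -> M -> R[i]).
Implicit Types (f g h : M -> R[i]) (F G : nat -> M -> R[i]).

Lemma smooth_const_series f : smooth setT f -> smooth_series setT (const_series f).
Proof. by move=> sf [|r] //; exact: smooth_cst. Qed.

Lemma star_const_r C F h k p : (forall r, bidifferential (C r)) ->
  smooth_series setT F -> smooth setT h ->
  star C F (const_series h) k p = \sum_(r < k.+1) C r (F (k - r)%N) h p.
Proof.
move=> HC sF sh; apply: eq_bigr => r _; rewrite big_ord_recr /= subnn big1 ?add0r//.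
move=> s _; rewrite /const_series subn_eq0 leqNgt ltn_ord /=.
by rewrite bidifferential0r.
Qed.

Lemma star_const_l C f G k p : (forall r, bidifferential (C r)) ->
  smooth setT f -> smooth_series setT G ->
  star C (const_series f) G k p = \sum_(r < k.+1) C r f (G (k - r)%N) p.
Proof.
move=> HC sf sG; apply: eq_bigr => r _; rewrite big_ord_recl /= subn0 big1 ?addr0//.
by move=> s _; rewrite /= bidifferential0l.
Qed.

Lemma star_const C f h k p : (forall r, bidifferential (C r)) ->
  smooth setT f -> smooth setT h ->
  star C (const_series f) (const_series h) k p = C k f h p.
Proof.
move=> HC sf sh; rewrite star_const_r//; last exact: smooth_const_series.
rewrite big_ord_recr /= subnn big1 ?add0r// => r _.
rewrite /const_series subn_eq0 leqNgt ltn_ord /=.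
by rewrite bidifferential0l.
Qed.

End StarProducts.

(** * The Hochschild cocycle of two star products *)

Section Difference.
Variables (R : realType) (n : nat) (M : pseudoKahler R n).
Variables (C C' : nat -> (M -> R[i]) -> (M -> R[i]) -> M -> R[i]).
Hypotheses (HC : star_product C) (HC' : star_product C').
Implicit Types (f g h : M -> R[i]) (F G : nat -> M -> R[i]).

(** Evaluated on series without higher terms, the associativity law becomes an
    identity between coefficients. *)
Lemma star_assoc_coef D k f g h p : star_product D ->
  smooth setT f -> smooth setT g -> smooth setT h ->
  \sum_(r < k.+1) D r (D (k - r)%N f g) h p = \sum_(r < k.+1) D r f (D (k - r)%N g h) p.
Proof.
move=> HD sf sg sh; have [bD _ _ _ assoc] := HD.
have E f1 f2 : smooth setT f1 -> smooth setT f2 ->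
    star D (const_series f1) (const_series f2) = fun r => D r f1 f2.
  by move=> s1 s2; apply/funext => r; apply/funext => q; exact: star_const.
have sD f1 f2 : smooth setT f1 -> smooth setT f2 ->
    smooth_series setT (fun r => D r f1 f2).
  by move=> s1 s2 r; exact: (bD r).1.
have := assoc _ _ _ (smooth_const_series sf) (smooth_const_series sg)
  (smooth_const_series sh) k p.
by rewrite !E// star_const_r//; [rewrite star_const_l//; exact: sD | exact: sD].
Qed.

Variable k : nat.
Hypothesis agree : forall r, (r < k.+1)%N -> forall f h, smooth setT f -> smooth setT h ->
  forall p, C r f h p = C' r f h p.

Let agree_fun r f h : (r < k.+1)%N -> smooth setT f -> smooth setT h ->
  C r f h = C' r f h.
Proof. by move=> rk sf sh; apply/funext => p; exact: agree. Qed.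

Let D f h p := C k.+1 f h p - C' k.+1 f h p.

(** Subtract the two associativity laws: in the inner terms all coefficients
    have an order for which the products agree, so these terms cancel and only
    the Hochschild coboundary of [D] is left. *)
Lemma difference_cocycle f g h p :
  smooth setT f -> smooth setT g -> smooth setT h ->
  D f g p * h p + D (fun q => f q * g q) h p
  = f p * D g h p + D f (fun q => g q * h q) p.
Proof.
move=> sf sg sh; have [bC C0 _ _ _] := HC; have [bC' C0' _ _ _] := HC'.
have C0E f1 f2 : smooth setT f1 -> smooth setT f2 -> C 0%N f1 f2 = fun q => f1 q * f2 q.
  by move=> s1 s2; apply/funext => q; exact: C0.
have C0E' f1 f2 : smooth setT f1 -> smooth setT f2 -> C' 0%N f1 f2 = fun q => f1 q * f2 q.
  by move=> s1 s2; apply/funext => q; exact: C0'.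
have sC r f1 f2 : smooth setT f1 -> smooth setT f2 -> smooth setT (C r f1 f2).
  by move=> s1 s2; exact: (bC r).1.
have sC' r f1 f2 : smooth setT f1 -> smooth setT f2 -> smooth setT (C' r f1 f2).
  by move=> s1 s2; exact: (bC' r).1.
have split (Phi : nat -> R[i]) :
    \sum_(r < k.+2) Phi r = Phi 0%N + (\sum_(i < k) Phi i.+1 + Phi k.+1).
  by rewrite big_ord_recl big_ord_recr.
have lk (i : 'I_k) : (i.+1 < k.+1)%N by rewrite ltnS.
have kl (i : 'I_k) : (k.+1 - i.+1 < k.+1)%N by rewrite subSS ltnS leq_subr.
have E := star_assoc_coef k.+1 p HC sf sg sh.
rewrite (split (fun r => C r (C (k.+1 - r)%N f g) h p)) in E.
rewrite (split (fun r => C r f (C (k.+1 - r)%N g h) p)) in E.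
have E' := star_assoc_coef k.+1 p HC' sf sg sh.
rewrite (split (fun r => C' r (C' (k.+1 - r)%N f g) h p)) in E'.
rewrite (split (fun r => C' r f (C' (k.+1 - r)%N g h) p)) in E'.
move: E E'; rewrite subn0 subnn C0//; last exact: sC.
rewrite C0'//; last exact: sC'.
rewrite C0//; last exact: sC.
rewrite C0'//; last exact: sC'.
rewrite !C0E// !C0E'//.
rewrite [X in _ + (X + _) = _ -> _](eq_bigr (fun i : 'I_k => C' i.+1 (C' (k.+1 - i.+1)%N f g) h p)); last first.
  by move=> i _; rewrite (agree_fun (kl i))// agree//; exact: sC'.
rewrite [X in _ = _ + (X + _) -> _](eq_bigr (fun i : 'I_k => C' i.+1 f (C' (k.+1 - i.+1)%N g h) p)); last first.
  by move=> i _; rewrite (agree_fun (kl i))// agree//; exact: sC'.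
rewrite /D; set S := \sum_(i < k) _; set T := \sum_(i < k) _ => E E'.
have := congr2 (fun x y => x - y) E E'.
move: (C k.+1 f g p) (C' k.+1 f g p) (C k.+1 g h p) (C' k.+1 g h p) => a a' b b'.
move: (C k.+1 _ h p) (C' k.+1 _ h p) (C k.+1 f _ p) (C' k.+1 f _ p) => e e' d d' H.
have -> : (a - a') * h p + (e - e') = a * h p + (S + e) - (a' * h p + (S + e')) by ring.
by rewrite H; ring.
Qed.

(** In the coefficient of order [k.+1] of a product of series, the coefficient
    [C k.+1] only meets the leading terms; in all other terms the two products
    agree. *)
Lemma star_agree_leading F G p : smooth_series setT F -> smooth_series setT G ->
  star C F G k.+1 p = star C' F G k.+1 p -> C k.+1 (F 0%N) (G 0%N) p = C' k.+1 (F 0%N) (G 0%N) p.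
Proof.
move=> sF sG; rewrite /star big_ord_recr [in RHS]big_ord_recr /= subnn !big_ord1.
rewrite [X in X + _ = _ -> _](eq_bigr (fun i : 'I_k.+1 =>
  \sum_(s < (k.+1 - i).+1) C' i (F s) (G (k.+1 - i - s)%N) p)); first by move/addrI.
by move=> i _; apply: eq_bigr => s _; apply: agree.
Qed.

End Difference.

(** * Complex coordinates and the nondegeneracy of the form *)

Section ComplexCoordinates.
Variables (R : realType) (n : nat) (M : pseudoKahler R n).
Implicit Types (c : chart R (n + n) M) (p q : M) (f : M -> R[i]) (s t : R[i]).

(** The parameter [s] stands for a square root of [-1], so that holomorphic and
    antiholomorphic objects are treated at once.  For [s] the imaginary unit
    these are [z^k] and [Zbar_k], for its opposite they are [zbar^k] and [Z_k]. *)
Definition lincoord s c (k : 'I_n) (q : M) : R[i] :=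
  (coord c q ord0 (lshift n k))%:C%C + s * (coord c q ord0 (rshift n k))%:C%C.

Definition wirtinger s c (k : 'I_n) f (q : M) : R[i] :=
  2^-1 * (partial c (lshift n k) f q + s * partial c (rshift n k) f q).

Lemma Z_wirtinger c k f : Z c k f = wirtinger (- 'i%C) c k f.
Proof. by apply/funext => q; rewrite /wirtinger mulNr. Qed.

Lemma smooth_lincoord s c k : smooth_chart c -> smooth (dom c) (lincoord s c k).
Proof.
move=> Hc; have oc : open (dom c) by exact: dom_open.
have sx j : smooth (dom c) (fun q => (coord c q ord0 j)%:C%C).
  by apply: smooth_real; exact: smoothR_coord.
by apply: smoothD => //; apply: smoothM => //; exact: smooth_cst.
Qed.

Lemma partial_real c j (u : M -> R) p :
  partial c j (fun q => (u q)%:C%C) p = (partialR c j u p)%:C%C.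
Proof. by rewrite /partial /= partialR_cst. Qed.

Lemma partial_lincoord s c c' j k p : smooth_chart c -> smooth_chart c' ->
  dom c p -> dom c' p ->
  partial c' j (lincoord s c k) p
  = (jac c' c p j (lshift n k))%:C%C + s * (jac c' c p j (rshift n k))%:C%C.
Proof.
move=> Hc Hc' cp c'p; have oc : open (dom c) by exact: dom_open.
have sx i : smooth (dom c) (fun q => (coord c q ord0 i)%:C%C).
  by apply: smooth_real; exact: smoothR_coord.
have sy := smoothM oc (smooth_cst _ s) (sx (rshift n k)).
rewrite (partialD j Hc' c'p cp (sx _) sy) (partialMl j s oc Hc' c'p cp (sx _)).
by rewrite !partial_real !mxE.
Qed.

Lemma jac_self c p : dom c p -> jac c c p = 1%:M.
Proof. by move=> cp; apply/matrixP => i j; rewrite !mxE partialR_coord. Qed.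

(** The Cauchy-Riemann equations: the Jacobian matrix intertwines the two
    standard complex structures. *)
Lemma jac_holomorphic c c' p (l k : 'I_n) :
  holomorphic_chart c -> holomorphic_chart c' -> dom c p -> dom c' p ->
  jac c c' p (rshift n l) (rshift n k) = jac c c' p (lshift n l) (lshift n k) /\
  jac c c' p (rshift n l) (lshift n k) = - jac c c' p (lshift n l) (rshift n k).
Proof.
move=> [Hc Ic] [Hc' Ic'] cp c'p; have [_ _ /(_ c' p Hc' cp c'p)] := cstructP Hc.
rewrite Ic// Ic'// -[jac c c' p]submxK !mulmx_block.
rewrite !mul0mx !mul1mx !mulmx0 !mulmx1 !mulNmx !mulmxN !mul1mx !mulmx1.
rewrite !add0r !addr0 => /eq_block_mx [E1 E2 _ _]; split.
  by move/matrixP: E2 => /(_ l k); rewrite block_mxEdr block_mxEul.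
by move/matrixP: E1 => /(_ l k); rewrite block_mxEdl block_mxEur !mxE.
Qed.

Lemma wirtinger_lincoord s c c' l k p : s * s = -1 ->
  holomorphic_chart c -> holomorphic_chart c' -> dom c p -> dom c' p ->
  wirtinger s c' l (lincoord s c k) p = 0.
Proof.
move=> ss Hc Hc' cp c'p; have [E1 E2] := jac_holomorphic l k Hc' Hc c'p cp.
rewrite /wirtinger !(partial_lincoord s _ _ Hc.1 Hc'.1 cp c'p) E1 E2.
rewrite rmorphN /=; set a := (jac _ _ _ _ (lshift n k))%:C%C.
transitivity (2^-1 * ((1 + s * s) * a)); first by ring.
by rewrite ss subrr mul0r mulr0.
Qed.

Lemma smooth_wirtinger s c k f : smooth_chart c -> smooth (dom c) f ->
  smooth (dom c) (wirtinger s c k f).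
Proof.
move=> Hc sf; have oc : open (dom c) by exact: dom_open.
have sp j : smooth (dom c) (partial c j f) by exact: smooth_partial.
apply: smoothM => //; first exact: smooth_cst.
by apply: smoothD => //; apply: smoothM => //; exact: smooth_cst.
Qed.

Lemma wirtingerC s t c k l f p : smooth_chart c -> dom c p -> smooth (dom c) f ->
  wirtinger s c k (wirtinger t c l f) p = wirtinger t c l (wirtinger s c k f) p.
Proof.
move=> Hc cp sf; have oc : open (dom c) by exact: dom_open.
have sp j : smooth (dom c) (partial c j f) by exact: smooth_partial.
have [P PE PC] : exists2 P : 'I_(n + n) -> 'I_(n + n) -> R[i],
    (forall i j, partial c i (partial c j f) p = P i j) & forall i j, P i j = P j i.
  exists (fun i j => partial c i (partial c j f) p) => i j; first exact: erefl.
  exact: (partialC i j Hc oc (fun _ => id) cp sf).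
have pw j u i : partial c j (wirtinger u c i f) p = 2^-1 *
    (P j (lshift n i) + u * P j (rshift n i)).
  have s1 := smoothM oc (smooth_cst _ u) (sp (rshift n i)).
  have s2 := smoothD oc (sp (lshift n i)) s1.
  rewrite (partialMl j _ oc Hc cp cp s2) (partialD j Hc cp cp (sp _) s1).
  by rewrite (partialMl j _ oc Hc cp cp (sp _)) !PE.
have E u j i : wirtinger u c j (wirtinger t c i f) p = 2^-1 *
    (partial c (lshift n j) (wirtinger t c i f) p + u * partial c (rshift n j) (wirtinger t c i f) p).
  by [].
have E' u j i : wirtinger u c j (wirtinger s c i f) p = 2^-1 *
    (partial c (lshift n j) (wirtinger s c i f) p + u * partial c (rshift n j) (wirtinger s c i f) p).
  by [].
rewrite E E' !pw (PC (lshift n l) (lshift n k)) (PC (lshift n l) (rshift n k)).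
rewrite (PC (rshift n l) (lshift n k)) (PC (rshift n l) (rshift n k)).
move: (P _ _) (P _ _) (P _ _) (P _ _) => A B A' B'; ring.
Qed.

Lemma i_sqr : 'i%C * 'i%C = -1 :> R[i].
Proof. by rewrite -expr2 sqr_i. Qed.

Lemma mulmx_dz (v : 'rV[R[i]]_(n + n)) k :
  v *m (dz R k)^T = (v ord0 (lshift n k) + 'i%C * v ord0 (rshift n k))%:M.
Proof.
apply/matrixP => i j; rewrite !ord1 /dz linearD linearZ /= !trmx_delta mulmxDr -scalemxAr.
by rewrite -!colE !mxE eqxx mulr1n.
Qed.

Lemma mulmx_dzbar (v : 'rV[R[i]]_(n + n)) k :
  v *m (dzbar R k)^T = (v ord0 (lshift n k) - 'i%C * v ord0 (rshift n k))%:M.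
Proof.
apply/matrixP => i j; rewrite !ord1 /dzbar linearB linearZ /= !trmx_delta mulmxBr -scalemxAr.
by rewrite -!colE !mxE eqxx mulr1n.
Qed.

(** The coefficients are the values of [dz_k] and [dzbar_k] on [v], so that only
    half of the terms remain for a vector of pure type. *)
Lemma sum_partial_wirtinger (v : 'rV[R[i]]_(n + n)) c f p :
  \sum_j v ord0 j * partial c j f p =
  \sum_k ((v ord0 (lshift n k) + 'i%C * v ord0 (rshift n k)) * Z c k f p
        + (v ord0 (lshift n k) - 'i%C * v ord0 (rshift n k)) * Zbar c k f p).
Proof.
rewrite big_split_ord /= -big_split; apply: eq_bigr => k _ /=.
rewrite /Z /Zbar.
set a := v _ _; set b := v _ _; set x := partial _ _ _ _; set y := partial _ _ _ _.
transitivity (2^-1 * 2 * (a * x + b * y)); first by rewrite mulVf ?mul1r// pnatr_eq0.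
transitivity (2^-1 * (2 * (a * x) - 2 * ('i%C * 'i%C) * (b * y))); last by ring.
by rewrite i_sqr; ring.
Qed.

(** Both the metric and the complex structure are invertible. *)
Lemma kahler_form_unit c p : smooth_chart c -> dom c p ->
  kahler_form c p \in unitmx.
Proof.
move=> Hc cp; rewrite /kahler_form map_unitmx unitmx_mul.
have [_ _ gU _] := metricP Hc; have [_ II _] := cstructP Hc.
rewrite gU// andbT.
have : cstruct c p *m (- cstruct c p) = 1%:M by rewrite mulmxN II// opprK.
by case/mulmx1_unit.
Qed.

Lemma unitmx_of_trivial_ker N (A : 'M[R[i]]_N) :
  (forall v : 'rV_N, v *m A = 0 -> v = 0) -> A \in unitmx.
Proof.
move=> H; rewrite -row_free_unit -kermx_eq0; apply/rowV0P => v.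
by move/sub_kermxP; exact: H.
Qed.

Lemma mulmx_partial c (w : 'I_(n + n) -> M -> R[i]) p (v : 'rV_(n + n)) j :
  (v *m \matrix_(i, j) partial c i (w j) p) ord0 j = \sum_i v ord0 i * partial c i (w j) p.
Proof. by rewrite mxE; apply: eq_bigr => i _; rewrite mxE. Qed.

(** Only one half of the complex coordinates satisfies the Wick condition; the
    functions [u] complete their differentials to a basis. *)
Definition frame s c (u : 'I_n -> M -> R[i]) (j : 'I_(n + n)) : M -> R[i] :=
  match fintype.split j with inl k => lincoord s c k | inr k => u k end.

Lemma frame_lshift s c u k : frame s c u (lshift n k) = lincoord s c k.
Proof. by rewrite /frame (unsplitK (inl k)). Qed.

Lemma frame_rshift s c u k : frame s c u (rshift n k) = u k.
Proof. by rewrite /frame (unsplitK (inr k)). Qed.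

Lemma frame_ker s c u p (v : 'rV_(n + n)) k : smooth_chart c -> dom c p ->
  v *m (\matrix_(i, j) partial c i (frame s c u j) p) = 0 ->
  v ord0 (lshift n k) + s * v ord0 (rshift n k) = 0 /\
  \sum_i v ord0 i * partial c i (u k) p = 0.
Proof.
move=> Hc cp vW; split.
  have := mulmx_partial c (frame s c u) p v (lshift n k).
  rewrite vW mxE frame_lshift => ->.
  rewrite (eq_bigr (fun i => (i == lshift n k)%:R * v ord0 i +
      s * ((i == rshift n k)%:R * v ord0 i))); last first.
    move=> i _; rewrite (partial_lincoord s i k Hc Hc cp cp) jac_self// !mxE.
    by rewrite !rmorph_nat; ring.
  rewrite big_split -mulr_sumr /=; congr (_ + _ * _).
    by rewrite (bigD1 (lshift n k))//= eqxx mul1r big1 ?addr0// => i /negbTE ->; rewrite mul0r.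
  by rewrite (bigD1 (rshift n k))//= eqxx mul1r big1 ?addr0// => i /negbTE ->; rewrite mul0r.
have := mulmx_partial c (frame s c u) p v (rshift n k).
by rewrite vW mxE frame_rshift => <-.
Qed.

Lemma mulmx_deldelbar (v : 'rV[R[i]]_(n + n)) c f p :
  v *m deldelbar c f p =
  \sum_k \sum_l Z c k (Zbar c l f) p *:
    ((v ord0 (lshift n k) + 'i%C * v ord0 (rshift n k)) *: dzbar R l
    - (v ord0 (lshift n l) - 'i%C * v ord0 (rshift n l)) *: dz R k).
Proof.
rewrite /deldelbar mulmx_sumr; apply: eq_bigr => k _.
rewrite mulmx_sumr; apply: eq_bigr => l _.
rewrite -scalemxAr /wedge mulmxBr !mulmxA mulmx_dz mulmx_dzbar.
by rewrite !mul_scalar_mx.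
Qed.

(** A tangent vector killed by all [dz_k] is of type (0,1).  If it also kills
    the functions [Z_k f], then by the symmetry of second derivatives it lies in
    the kernel of the two-form, which is trivial. *)
Lemma frame_Z_unit c f p : smooth_chart c -> dom c p -> smooth (dom c) f ->
  deldelbar c f p \in unitmx ->
  (\matrix_(i, j) partial c i (frame 'i%C c (fun k => Z c k f) j) p) \in unitmx.
Proof.
move=> Hc cp sf uK; apply: unitmx_of_trivial_ker => v vW.
apply: (can_inj (mulmxK uK)); rewrite mul0mx mulmx_deldelbar big1// => k _.
have v10 l := (frame_ker l Hc cp vW).1.
have Hk : \sum_l (v ord0 (lshift n l) - 'i%C * v ord0 (rshift n l))
    * Zbar c l (Z c k f) p = 0.
  have [_ H] := frame_ker k Hc cp vW; rewrite -[RHS]H sum_partial_wirtinger.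
  by apply: eq_bigr => l _; rewrite v10 mul0r add0r.
rewrite v10; under eq_bigr do rewrite scale0r sub0r scalerN scalerA.
rewrite sumrN -scaler_suml.
suff -> : \sum_l Z c k (Zbar c l f) p * (v ord0 (lshift n l) - 'i%C * v ord0 (rshift n l)) = 0.
  by rewrite scale0r oppr0.
rewrite -[RHS]Hk; apply: eq_bigr => l _; rewrite mulrC; congr (_ * _).
by rewrite !Z_wirtinger; exact: wirtingerC.
Qed.

(** Conjugate to [frame_Z_unit]: now the vector is of type (1,0). *)
Lemma frame_Zbar_unit c f p : smooth_chart c -> dom c p -> smooth (dom c) f ->
  deldelbar c f p \in unitmx ->
  (\matrix_(i, j) partial c i (frame (- 'i%C) c (fun l => Zbar c l f) j) p) \in unitmx.
Proof.
move=> Hc cp sf uK; apply: unitmx_of_trivial_ker => v vW.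
apply: (can_inj (mulmxK uK)); rewrite mul0mx mulmx_deldelbar exchange_big big1// => l _.
have v01 k : v ord0 (lshift n k) - 'i%C * v ord0 (rshift n k) = 0.
  by have := (frame_ker k Hc cp vW).1; rewrite mulNr.
have Hl : \sum_k (v ord0 (lshift n k) + 'i%C * v ord0 (rshift n k))
    * Z c k (Zbar c l f) p = 0.
  have [_ H] := frame_ker l Hc cp vW; rewrite -[RHS]H sum_partial_wirtinger.
  by apply: eq_bigr => k _; rewrite v01 mul0r addr0.
rewrite v01; under eq_bigr do rewrite scale0r subr0 scalerA.
rewrite -scaler_suml.
suff -> : \sum_k Z c k (Zbar c l f) p * (v ord0 (lshift n k) + 'i%C * v ord0 (rshift n k)) = 0.
  by rewrite scale0r.
by rewrite -[RHS]Hl; apply: eq_bigr => k _; rewrite mulrC.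
Qed.

End ComplexCoordinates.

(** * Star products of Wick type *)

Section WickCoordinates.
Variables (R : realType) (n : nat) (M : pseudoKahler R n).
Implicit Types (c : chart R (n + n) M) (p q : M) (f h w : M -> R[i]).

Lemma wirtinger_near s c k p f h : dom c p -> (\forall q \near p, f q = h q) ->
  wirtinger s c k f p = wirtinger s c k h p.
Proof.
by move=> cp fh; rewrite /wirtinger (partial_near _ cp fh) (partial_near (rshift n k) cp fh).
Qed.

Lemma wirtinger_cst s c k (a : R[i]) p : wirtinger s c k (fun=> a) p = 0.
Proof. by rewrite /wirtinger !partial_cst mulr0 addr0 mulr0. Qed.

(** The holomorphic functions of the Wick condition are tested in all
    holomorphic charts, not only in the one that provides the coordinate. *)
Lemma near_lincoord_wirtinger s c i w p : s * s = -1 -> holomorphic_chart c ->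
  dom c p -> (\forall q \near p, w q = lincoord s c i q) ->
  exists U, [/\ open U, U p & forall c' q, holomorphic_chart c' -> dom c' q -> U q ->
    forall l, wirtinger s c' l w q = 0].
Proof.
move=> ss Hc cp wp; pose S := [set q | w q = lincoord s c i q /\ dom c q].
exists S^°; split.
- exact: open_interior.
- by apply: filterS2 wp (near_dom cp) => q wq cq; split.
move=> c' q Hc' c'q Sq l; have [_ cq] := interior_subset Sq.
rewrite (@wirtinger_near _ _ _ _ _ (lincoord s c i))//; first exact: wirtinger_lincoord.
by apply: filterS Sq => r [].
Qed.

(** The product with a function that is holomorphic near [p] is the pointwise
    one there, to which only the order zero contributes. *)
Lemma wick_holomorphic C k c i f w p : star_product C -> wick_type C ->
  holomorphic_chart c -> dom c p -> smooth setT f -> smooth setT w ->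
  (\forall q \near p, w q = lincoord 'i%C c i q) -> C k.+1 f w p = 0.
Proof.
move=> [bC _ _ _ _] HW Hc cp sf sw wp.
have [U [oU Up HU]] := near_lincoord_wirtinger (i_sqr R) Hc cp wp.
have s0 := smooth_cst (M := M) setT 0.
rewrite -(star_const _ _ bC sf sw).
apply: (HW U f (fun=> 0) w (fun=> 0) oU sf s0 sw s0 _ _ k.+1 p Up).1.
  by split=> //; apply: smooth_sub sw.
split=> [|c' q _ _ _ l]; first exact: smooth_cst.
by rewrite Z_wirtinger wirtinger_cst.
Qed.

Lemma wick_antiholomorphic C k c i f w p : star_product C -> wick_type C ->
  holomorphic_chart c -> dom c p -> smooth setT f -> smooth setT w ->
  (\forall q \near p, w q = lincoord (- 'i%C) c i q) -> C k.+1 w f p = 0.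
Proof.
move=> [bC _ _ _ _] HW Hc cp sf sw wp.
have ii : - 'i%C * - 'i%C = -1 :> R[i] by rewrite mulrNN i_sqr.
have [U [oU Up HU]] := near_lincoord_wirtinger ii Hc cp wp.
have s0 := smooth_cst (M := M) setT 0.
rewrite -(star_const _ _ bC sw sf).
apply: (HW U (fun=> 0) f (fun=> 0) w oU s0 sf s0 sw _ _ k.+1 p Up).2.
  split=> [|c' q _ _ _ l]; first exact: smooth_cst.
  exact: (wirtinger_cst 'i%C c' l 0 q).
split; first exact: smooth_sub sw.
by move=> c' q Hc' c'q Uq l; rewrite Z_wirtinger; exact: HU.
Qed.

Lemma exists_global_family c p (t : 'I_(n + n) -> M -> R[i]) : dom c p ->
  (forall j, smooth (dom c) (t j)) ->
  exists w : 'I_(n + n) -> M -> R[i], forall j,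
    smooth setT (w j) /\ \forall q \near p, w j q = t j q.
Proof.
move=> cp st.
have /choice [w Hw] : forall j, exists w : M -> R[i],
    smooth setT w /\ \forall q \near p, w q = t j q.
  by move=> j; apply: (exists_global (dom_open c) cp).
by exists w.
Qed.

Lemma smooth_frame s c u j : smooth_chart c -> (forall k, smooth (dom c) (u k)) ->
  smooth (dom c) (frame s c u j).
Proof.
by move=> Hc su; rewrite /frame; case: (fintype.split j) => k //; exact: smooth_lincoord.
Qed.

(** Strong induction on the order; at order zero both products are pointwise. *)
Lemma coincide_by_order (C C' : nat -> (M -> R[i]) -> (M -> R[i]) -> M -> R[i]) :
  star_product C -> star_product C' ->
  (forall k, (forall r, (r < k.+1)%N -> forall f h, smooth setT f -> smooth setT h ->
      forall p, C r f h p = C' r f h p) ->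
    forall f h, smooth setT f -> smooth setT h -> forall p, C k.+1 f h p = C' k.+1 f h p) ->
  coincide C C'.
Proof.
move=> [_ C0 _ _ _] [_ C0' _ _ _] step.
have H r : forall f h, smooth setT f -> smooth setT h -> forall p, C r f h p = C' r f h p.
  have [N] := ubnP r; elim: N r => // N IH [|k] rN f h sf sh p.
    by rewrite C0// C0'.
  by apply: step => // r rk; apply: IH; apply: leq_trans rk _.
move=> f h sf sh k p; apply: eq_bigr => r _; apply: eq_bigr => s _.
by apply: H.
Qed.

End WickCoordinates.

Section Main.
Variables (R : realType) (n : nat) (M : pseudoKahler R n).
Variables (C C' : nat -> (M -> R[i]) -> (M -> R[i]) -> M -> R[i]).
Hypotheses (HC : star_product C) (HCW : wick_type C).
Hypotheses (HC' : star_product C') (HCW' : wick_type C').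
Variable k : nat.
Hypothesis agree : forall r, (r < k.+1)%N -> forall f h, smooth setT f -> smooth setT h ->
  forall p, C r f h p = C' r f h p.
Variables (c : chart R (n + n) M) (p : M) (phi : nat -> M -> R[i]).
Hypotheses (Hc : holomorphic_chart c) (cp : dom c p).
Hypothesis sphi : smooth_series (dom c) phi.
Hypothesis uphi : deldelbar c (phi 0%N) p \in unitmx.

Let bC r : bidifferential (C r). Proof. by case: HC. Qed.
Let bC' r : bidifferential (C' r). Proof. by case: HC'. Qed.

Let extension_eq f : smooth setT f -> \forall q \near p, extension p f q = f q.
Proof. by move=> sf; apply: extension_near sf => //; exact: openT. Qed.

Let extension_eq_dom u g : smooth (dom c) u -> (\forall q \near p, g q = u q) ->
  \forall q \near p, extension p u q = g q.
Proof.
move=> su gu; have := extension_near (dom_open c) cp su.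
by move=> H; apply: filterS2 H gu => q -> ->.
Qed.

Let frame_global s u : (forall j, smooth (dom c) (u j)) ->
  (\matrix_(i, j) partial c i (frame s c u j) p) \in unitmx ->
  exists w : 'I_(n + n) -> M -> R[i], [/\ forall j, smooth setT (w j),
    forall j, \forall q \near p, w (lshift n j) q = lincoord s c j q,
    forall j, \forall q \near p, w (rshift n j) q = u j q &
    (\matrix_(i, j) partial c i (w j) p) \in unitmx].
Proof.
move=> su uW; have [w Hw] := exists_global_family cp (fun j => smooth_frame s j Hc.1 su).
exists w; split=> [j|j|j|]; first exact: (Hw j).1.
- by have := (Hw (lshift n j)).2; rewrite frame_lshift.
- by have := (Hw (rshift n j)).2; rewrite frame_rshift.
rewrite (_ : (\matrix_(i, j) _) = \matrix_(i, j) partial c i (frame s c u j) p)//.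
apply/matrixP => i j; rewrite !mxE; apply: (partial_near _ cp); exact: (Hw j).2.
Qed.

(** The coordinates satisfy [D(-, w) = 0] by the Wick property, and the
    functions [Z_k(phi_0)] by the hypothesis at order [k.+1], where only their
    leading terms meet [D]. *)
Lemma coef_agree_right :
  (forall j f, smooth setT f ->
    star_restr C (const_series f) (fun s => Z c j (phi s)) k.+1 p
    = star_restr C' (const_series f) (fun s => Z c j (phi s)) k.+1 p) ->
  forall f h, smooth setT f -> smooth setT h -> C k.+1 f h p = C' k.+1 f h p.
Proof.
move=> HZ f h sf sh.
have sZ s j : smooth (dom c) (Z c j (phi s)).
  by rewrite Z_wirtinger; exact: smooth_wirtinger Hc.1 (sphi s).
have [w [sw wl wr uw]] := frame_global (sZ 0%N) (frame_Z_unit Hc.1 cp (sphi 0%N) uphi).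
have Dw j g : smooth setT g -> C k.+1 g (w j) p = C' k.+1 g (w j) p.
  move=> sg; case: (split_ordP j) => i ->.
    by rewrite (wick_holomorphic k HC HCW Hc cp sg (sw _) (wl i))
               (wick_holomorphic k HC' HCW' Hc cp sg (sw _) (wl i)).
  have := @star_agree_leading R n M C C' k agree
    (fun s => extension p (const_series g s)) (fun s => extension p (Z c i (phi s))) p
    (fun s => extension_smooth _ _) (fun s => extension_smooth _ _) (HZ i g sg).
  have sE := @extension_smooth R (n + n) M p.
  have eF := extension_eq sg; have eG := extension_eq_dom (sZ 0%N i) (wr i).
  rewrite (bidifferential_nearl (bC _) (sE _) sg (sE _) eF).
  rewrite (bidifferential_nearl (bC' _) (sE _) sg (sE _) eF).
  rewrite (bidifferential_nearr (bC _) sg (sE _) (sw _) eG).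
  by rewrite (bidifferential_nearr (bC' _) sg (sE _) (sw _) eG).
apply: (bidifferential_eq_of_frame (bC _) (bC' _) Hc.1 cp sf sw uw) => // [|j g sg].
  have [_ _ _ C1 _] := HC; have [_ _ _ C1' _] := HC'.
  by rewrite (C1 k f 1 sf p).2 (C1' k f 1 sf p).2.
have := difference_cocycle HC HC' agree p sf sg (sw j).
rewrite !Dw//; last by apply: smoothM => //; exact: openT.
rewrite !subrr mulr0 addr0 add0r => E; rewrite mulrC E.
by congr (C _ _ _ _ - C' _ _ _ _); apply/funext => q; rewrite mulrC.
Qed.

(** As [coef_agree_right], with the roles of the two arguments exchanged: the
    cocycle identity with [w] in the first place gives
    [D(w g, h) = w(p) D(g, h)]. *)
Lemma coef_agree_left :
  (forall j f, smooth setT f ->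
    star_restr C (fun s => Zbar c j (phi s)) (const_series f) k.+1 p
    = star_restr C' (fun s => Zbar c j (phi s)) (const_series f) k.+1 p) ->
  forall f h, smooth setT f -> smooth setT h -> C k.+1 f h p = C' k.+1 f h p.
Proof.
move=> HZ f h sf sh.
have sZ s j : smooth (dom c) (Zbar c j (phi s)).
  exact: (smooth_wirtinger 'i%C j Hc.1 (sphi s)).
have [w [sw wl wr uw]] := frame_global (sZ 0%N) (frame_Zbar_unit Hc.1 cp (sphi 0%N) uphi).
have Dw j g : smooth setT g -> C k.+1 (w j) g p = C' k.+1 (w j) g p.
  move=> sg; case: (split_ordP j) => i ->.
    by rewrite (wick_antiholomorphic k HC HCW Hc cp sg (sw _) (wl i))
               (wick_antiholomorphic k HC' HCW' Hc cp sg (sw _) (wl i)).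
  have := @star_agree_leading R n M C C' k agree
    (fun s => extension p (Zbar c i (phi s))) (fun s => extension p (const_series g s)) p
    (fun s => extension_smooth _ _) (fun s => extension_smooth _ _) (HZ i g sg).
  have sE := @extension_smooth R (n + n) M p.
  have eF := extension_eq sg; have eG := extension_eq_dom (sZ 0%N i) (wr i).
  rewrite (bidifferential_nearr (bC _) (sE _) (sE _) sg eF).
  rewrite (bidifferential_nearr (bC' _) (sE _) (sE _) sg eF).
  rewrite (bidifferential_nearl (bC _) (sE _) (sw _) sg eG).
  by rewrite (bidifferential_nearl (bC' _) (sE _) (sw _) sg eG).
apply: (bidifferential_eq_of_frame (bidifferential_flip (bC _)) (bidifferential_flip (bC' _))
  Hc.1 cp sh sw uw) => // [|j g sg].
  have [_ _ _ C1 _] := HC; have [_ _ _ C1' _] := HC'.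
  by rewrite (C1 k h 1 sh p).1 (C1' k h 1 sh p).1.
have := difference_cocycle HC HC' agree p (sw j) sg sh.
rewrite !Dw//; last by apply: smoothM => //; exact: openT.
by rewrite !subrr mul0r addr0 add0r.
Qed.

End Main.

Theorem theorem5p2 (R : realType) (n : nat) (M : pseudoKahler R n)
  (C C' : nat -> (M -> R[i]) -> (M -> R[i]) -> M -> R[i])
  (HC : star_product C) (HCW : wick_type C)
  (HC' : star_product C') (HCW' : wick_type C')
  (J : Type) (c : J -> chart R (n + n) M)
  (Hc : forall gamma, holomorphic_chart (c gamma))
  (Hcover : good_open_cover (fun gamma => dom (c gamma)))
  (K : nat -> chart R (n + n) M -> M -> 'M[R[i]]_(n + n))
  (HK : formal_deformation K)
  (phi : J -> nat -> M -> R[i])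
  (Hphi : forall gamma, smooth_series (dom (c gamma)) (phi gamma))
  (Hpot : forall gamma r p, dom (c gamma) p ->
     K r (c gamma) p = deldelbar (c gamma) (phi gamma r) p) :
  ((forall gamma (k : 'I_n) (f : nat -> M -> R[i]),
      smooth_series (dom (c gamma)) f ->
      forall r p, dom (c gamma) p ->
        star_restr C f (fun s => Z (c gamma) k (phi gamma s)) r p
        = star_restr C' f (fun s => Z (c gamma) k (phi gamma s)) r p) ->
   coincide C C')
  /\
  ((forall gamma (l : 'I_n) (f : nat -> M -> R[i]),
      smooth_series (dom (c gamma)) f ->
      forall r p, dom (c gamma) p ->
        star_restr C (fun s => Zbar (c gamma) l (phi gamma s)) f r p
        = star_restr C' (fun s => Zbar (c gamma) l (phi gamma s)) f r p) ->
   coincide C C').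
Proof.
have [_ cover _] := Hcover.
have uphi gamma p : dom (c gamma) p -> deldelbar (c gamma) (phi gamma 0%N) p \in unitmx.
  move=> cp; rewrite -Hpot// HK.1//; last exact: (Hc gamma).1.
  exact: kahler_form_unit (Hc gamma).1 cp.
have sconst gamma f : smooth setT f -> smooth_series (dom (c gamma)) (const_series f).
  by move=> sf r; apply: smoothT_dom; exact: smooth_const_series.
split=> H; apply: coincide_by_order => // k agree f h sf sh p;
  have [gamma cp] := cover p.
- apply: (coef_agree_right HC HCW HC' HCW' agree (Hc gamma) cp (Hphi gamma)) => //.
    exact: uphi.
  by move=> j g sg; apply: H => //; exact: sconst.
- apply: (coef_agree_left HC HCW HC' HCW' agree (Hc gamma) cp (Hphi gamma)) => //.
    exact: uphi.
  by move=> j g sg; apply: H => //; exact: sconst.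
Qed.
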